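(* Let $(n,d)=(2,4)$ or $(n,d)=(3,3)$. For every $f\in\mathbb{X}_n^d$ the restrictions $\mathbb{\Phi}\big|_{O(f)}$ and $\varphi_f\big|_{O(f)}$ coincide upon the canonical identification $\mathbb{P}(\mathcal{Q}_n^{d*})=\mathbb{P}(\mathcal{Q}_n^d)^*$.
   Context: $\mathcal{Q}_n^d=\mathrm{Sym}^d(\mathbb{C}^{n*})$ is the complex vector space of forms of degree $d$ in $z_1,\dots,z_n$, with $\mathrm{GL}_n(\mathbb{C})$ acting by $(C\cdot f)(z)=f(C^{-1}z)$; $\mathbb{P}(\mathcal{Q}_n^d)=(\mathcal{Q}_n^d\setminus\{0\})/\mathbb{C}^\times$ with the induced $\mathrm{SL}_n(\mathbb{C})$-action. $X_n^d\subset\mathcal{Q}_n^d$ is the set of forms with nonzero discriminant, i.e. forms $f$ whose partial derivatives $f_j=\partial f/\partial z_j$, $j=1,\dots,n$, have no common zero except the origin; $\mathbb{X}_n^d$ is its image in $\mathbb{P}(\mathcal{Q}_n^d)$. For $f\in\mathbb{P}(\mathcal{Q}_n^d)$, $O(f)=\mathrm{SL}_n(\mathbb{C})\cdot f$. Associated form and $\mathbb{\Phi}$: for $f\in X_n^d$ let $M_f=\mathbb{C}[z_1,\dots,z_n]/(f_1,\dots,f_n)$, a finite-dimensional local Gorenstein algebra whose socle is one-dimensional, equals the degree $n(d-2)$ part of $M_f$, and is spanned by the class of the Hessian $H(f)=\det(\partial^2 f/\partial z_i\partial z_j)$. Let $\omega:\mathrm{Soc}(M_f)\to\mathbb{C}$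 be the linear isomorphism with $\omega(H(f))=1$, and $\mathbf{z}_j\in M_f$ the class of $z_j$. The associated form of $f$ is $\mathbf{f}(z^* )=\omega\big((z_1^*\mathbf{z}_1+\dots+z_n^*\mathbf{z}_n)^{n(d-2)}\big)$, a form of degree $n(d-2)$ on $\mathbb{C}^{n*}$, i.e. an element of $\mathrm{Sym}^{n(d-2)}(\mathbb{C}^n)$. Via the polar pairing, $F\in\mathrm{Sym}^N(\mathbb{C}^n)$ is identified with the linear functional $g\mapsto \frac{1}{N!}F(\partial/\partial z_1,\dots,\partial/\partial z_n)(g)$ on $\mathcal{Q}_n^N$, so $\mathbf{f}$ is an element of $\mathcal{Q}_n^{n(d-2)*}$ (dual space). The map $f\mapsto\mathbf{f}$ descends to a morphism $\mathbb{\Phi}:\mathbb{X}_n^d\to\mathbb{P}(\mathcal{Q}_n^{n(d-2)*})$; for $(n,d)=(2,4),(3,3)$ one has $n(d-2)=d$. The map $\varphi_f$: for a complex vector space $W$, $\mathbb{P}(W)^*$ denotes the variety of hyperplanes in $W$, canonically identified with $\mathbb{P}(W^* )$ (a nonzero functional corresponds to its kernel). In the two cases considered, for $f\in\mathbb{X}_n^d$ the orbit $O(f)$ is a smooth irreducible hypersurface in $\mathbb{X}_n^d$, so its Zariski closure $\overline{O(f)}$ in $\mathbb{P}(\mathcal{Q}_n^d)$ is an irreducible hypersurface whose regular locus contains $O(f)$. Let $\hat X\subset\mathcal{Q}_n^d$ be the affine cone over $\overline{O(f)}$. Then $\varphi_f:\overline{O(f)}_{\mathrm{reg}}\to\mathbb{P}(\mathcal{Q}_n^d)^*$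 is the map $x\mapsto T_{\hat x}(\hat X)\subset\mathcal{Q}_n^d$, where $\hat x\in\hat X$ is any point lying over $x$ and the tangent space is viewed as a linear hyperplane of $\mathcal{Q}_n^d$. *)

(* Defs.v *)
From HB Require Import structures.
From mathcomp Require Import all_boot all_order all_algebra.
From mathcomp Require Import generic_quotient ring_quotient.
From mathcomp Require Import boolp classical_sets reals.
From mathcomp Require Import complex.
From mathcomp Require Import mpoly.

Set Implicit Arguments.
Unset Strict Implicit.
Unset Printing Implicit Defensive.

Import GRing.Theory.
Local Open Scope ring_scope.
Local Open Scope quotient_scope.
Local Open Scope classical_set_scope.

(* Points of P(V) are the lines <[v]>%VS (v != 0) of V; a subset of P(V) is a
   [set {vspace V}], and a hyperplane of V is given as a [set V]. *)
Section Projective.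
Variables (K : fieldType) (V : vectType K).
Implicit Types (v w : V) (L : {vspace V}) (S : set {vspace V}) (A : set V).

Definition coords v : 'I_(\dim {:V}) -> K :=
  fun i => coord (vbasis {:V}) i v.

(* A polynomial function on V is a polynomial in the coordinates. *)
Definition pol_eval (P : {mpoly K[\dim {:V}]}) v : K := P.@[coords v].

Definition pol_diff (P : {mpoly K[\dim {:V}]}) v w : K :=
  \sum_i (P^`M(i)).@[coords v] * coords w i.

Definition vanishes_on (P : {mpoly K[\dim {:V}]}) L : Prop :=
  forall v, v \in L -> pol_eval P v = 0.

Definition zariski_closure S : set {vspace V} :=
  [set L | \dim L = 1%N /\
    forall (k : nat) (P : {mpoly K[\dim {:V}]}), P \is k.-homog ->
      (forall L', S L' -> vanishes_on P L') -> vanishes_on P L].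

Definition affine_cone S : set V := [set v | v = 0 \/ S <[v]>%VS].

(* Zariski tangent space of the affine variety A at v, as a subspace of V. *)
Definition tangent_space A v : set V :=
  [set w | forall P : {mpoly K[\dim {:V}]},
     (forall a, A a -> pol_eval P a = 0) -> pol_diff P v w = 0].

(* The canonical identification P(V^* ) = P(V)^*: L is a point of P(V^* ) and
   H is the common kernel of the functionals on the line L. *)
Definition corresponds (L : {vspace 'Hom(V, K^o)}) (H : set V) : Prop :=
  \dim L = 1%N /\ H = [set w | forall l, l \in L -> l w = 0].

End Projective.

(* The number of variables is n = n'.+1 and the degree is d = d'.+2: forms in
   n >= 1 variables are a vectType in the library, and for d >= 2 the ideal of
   the partial derivatives is proper, so that M_f is a nonzero ring. *)
Section Forms.
Variables (K : fieldType) (n' d' : nat).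
Local Notation n := n'.+1.
Local Notation d := d'.+2.
Local Notation Q := (dhomog n K d).
Local Notation N := (n * (d - 2))%N.

Definition subst_inv (C : 'M[K]_n) : n.-tuple {mpoly K[n]} :=
  [tuple \sum_j invmx C i j *: 'X_j | i < n].

Lemma subst_inv_homog (C : 'M[K]_n) (f : Q) :
  (mpoly_of_dhomog f \mPo subst_inv C) \is d.-homog.
Proof.
rewrite comp_mpolyE big_seq; apply: rpred_sum => m hm; apply: rpredZ.
have hd : mdeg m = d.
  by have /dhomogP/(_ _ hm) := dhomog_is_dhomog f.
rewrite -hd mdegE.
elim/big_ind2: _ => [|p k q l hp hq|i _].
- exact: dhomog1.
- exact: dhomogM.
- suff h1 : tnth (subst_inv C) i \is 1.-homog.
    by have := dhomogMn (m i) h1; rewrite mul1n.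
  rewrite tnth_mktuple; apply: rpred_sum => j _; apply: rpredZ.
  by rewrite dhomogX /= mdeg1.
Qed.

(* (C . f)(z) = f (C^-1 z) *)
Definition act (C : 'M[K]_n) (f : Q) : Q := DHomog (subst_inv_homog C f).

Definition SL_orbit (x : {vspace Q}) : set {vspace Q} :=
  [set y | exists C : 'M[K]_n, \det C = 1 /\ y = (linfun (act C) @: x)%VS].

(* Forms with nonzero discriminant, and their image in the projective space. *)
Definition smooth_form : set Q :=
  [set f | forall z : 'I_n -> K,
     (forall j, ((mpoly_of_dhomog f)^`M(j)).@[z] = 0) -> forall i, z i = 0].

Definition smooth_point : set {vspace Q} :=
  [set x | exists2 f : Q, smooth_form f & x = <[f]>%VS].

(** The algebra M_f *)

Definition jac_ideal (f : Q) : {pred {mpoly K[n]}} :=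
  fun h => `[< exists a : 'I_n -> {mpoly K[n]},
                 h = \sum_j a j * (mpoly_of_dhomog f)^`M(j) >].

Lemma jac_idealr_closed (f : Q) : idealr_closed (jac_ideal f).
Proof.
split.
- by apply/asboolP; exists (fun=> 0); rewrite big1 // => j _; rewrite mul0r.
- apply/asboolP => -[a] /(congr1 (meval (fun=> 0))).
  rewrite rmorph1 raddf_sum big1 => [/eqP|j _]; first by rewrite oner_eq0.
  rewrite /= mevalM; suff -> : ((mpoly_of_dhomog f)^`M(j)).@[fun=> 0] = 0.
    by rewrite mulr0.
  rewrite mevalE big_seq big1 // => m hm.
  suff [i hi] : exists i, m i != 0%N.
    by rewrite (bigD1 i) //= expr0n (negPf hi) mul0r mulr0.
  apply/existsP; apply: contraLR hm; rewrite negb_exists => /forallP h.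
  have -> : m = 0%MM by apply/mnmP => i; rewrite mnm0E; apply/eqP/negPn/h.
  rewrite mcoeff_msupp negbK mcoeff_deriv add0m.
  rewrite (dhomog_nemf_coeff (dhomog_is_dhomog f)) ?mul0rn //=.
  by rewrite mdeg1.
- move=> a u v /asboolP[b ->] /asboolP[c ->]; apply/asboolP.
  exists (fun j => a * b j + c j); rewrite mulr_sumr -big_split /=.
  by apply: eq_bigr => j _; rewrite mulrDl mulrA.
Qed.

HB.instance Definition _ (f : Q) :=
  isIdealr.Build {mpoly K[n]} (jac_ideal f) (jac_idealr_closed f).

Definition milnor (f : Q) : comNzRingType := {ideal_quot (jac_ideal f)}.

Definition cls (f : Q) (h : {mpoly K[n]}) : milnor f :=
  \pi_({ideal_quot (jac_ideal f)}) h.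

Definition hessian (f : Q) : {mpoly K[n]} :=
  \det (\matrix_(i < n, j < n) (mpoly_of_dhomog f)^`M(i)^`M(j)).

(* The annihilator of the maximal ideal (z_1, ..., z_n). *)
Definition socle (f : Q) : set (milnor f) :=
  [set x | forall j : 'I_n, cls f 'X_j * x = 0].

(* w restricts to a K-linear isomorphism from the socle onto K that maps the
   class of the Hessian to 1; its values off the socle are irrelevant. *)
Definition is_omega (f : Q) (w : milnor f -> K) : Prop :=
  [/\ forall (c : K) (x y : milnor f), socle x -> socle y ->
        w (cls f c%:MP * x + y) = c * w x + w y,
      forall x, socle x -> w x = 0 -> x = 0,
      forall c, exists2 x, socle x & w x = c
    & w (cls f (hessian f)) = 1].

Definition omega (f : Q) : milnor f -> K :=
  xget (fun=> 0) [set w | is_omega w].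

(* omega ((z*_1 z_1 + ... + z*_n z_n)^N), with the powers expanded in
   M_f[z*_1, ..., z*_n] and omega applied coefficientwise. *)
Definition associated_form (f : Q) : {mpoly K[n]} :=
  map_mpoly (@omega f)
    ((\sum_j (cls f 'X_j)%:MP * 'X_j : {mpoly (milnor f)[n]}) ^+ N).

(* g |-> F(d/dz_1, ..., d/dz_n)(g) / N!, a constant polynomial if g and F are
   homogeneous of degree N. *)
Definition polar (F : {mpoly K[n]}) : 'Hom(dhomog n K N, K^o) :=
  linfun (fun g : dhomog n K N =>
    (\sum_(m <- msupp F) F@_m *: (mpoly_of_dhomog g)^`M[m])@_0%MM
      / (N`!)%:R : K^o).

(** The two maps; the chosen representative [vpick y] of [y] is immaterial. *)

Definition Phi (y : {vspace Q}) : {vspace 'Hom(dhomog n K N, K^o)} :=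
  <[polar (associated_form (vpick y))]>%VS.

(* phi x y is phi_f(y) for x = [f]; it is only meaningful at regular points y
   of the closure of the orbit of x, in particular on that orbit. *)
Definition phi (x y : {vspace Q}) : set Q :=
  tangent_space (affine_cone (zariski_closure (SL_orbit x))) (vpick y).

End Forms.

(* Main.v *)
(* The kernel of the polar functional of the associated form of g is the part of
   degree d of the Jacobian ideal J = (g_1, ..., g_n), because n(d-2) = d and the
   functional is w |-> omega(w mod J). This part is spanned by the forms
   z_b g_a, that is, it is the tangent space gl_n . g to the cone over the orbit
   of g. So the theorem says that the Zariski tangent space T of the cone over
   the orbit closure is not larger.

   Algebra: by the Nullstellensatz J contains a power of every variable, hence
   the Koszul complex of (g_1, ..., g_n) is exact (n = 2, 3), and chasing the
   comparison with the Koszul complex of (z_1, ..., z_n) shows that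
   (J : (z_1, ..., z_n)) = J + (det A), where g_i = sum_j A_ij z_j. As A can be
   taken proportional to the Hessian matrix, the socle is spanned by the class
   of the Hessian, which is nonzero since M_g has a nonzero socle.

   Geometry: J_d is contained in T by differentiating along t |-> g o (1 + tE).
   Conversely, since n^2 < dim Q, the coordinates of g o M are algebraically
   dependent, so some nonzero form P vanishes on the GL_n-orbit of g. If P has
   least degree, a partial derivative of P does not vanish identically on the
   orbit; pulling P back by an element of GL_n gives a form vanishing on the
   cone whose differential at g is nonzero. Hence T is a proper subspace
   containing the hyperplane J_d. *)

From HB Require Import structures.
Require Import Defs.
From mathcomp Require Import all_boot all_order all_algebra.
From mathcomp Require Import perm generic_quotient ring_quotient finmap ring lra.
From mathcomp Require Import boolp classical_sets functions cardinality.
From mathcomp Require Import reals complex mpoly.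

Set Implicit Arguments.
Unset Strict Implicit.
Unset Printing Implicit Defensive.

Import GRing.Theory.
Local Open Scope ring_scope.
Local Open Scope quotient_scope.
Local Open Scope classical_set_scope.

(** * Koszul complexes and the socle of a complete intersection *)

Section Koszul2.
Variables (S : comNzRingType) (x y : S).
Hypothesis regx : forall s, x * s = 0 -> s = 0.
Hypothesis regy : forall s p, y * s = x * p -> exists q, s = x * q.
Variables f1 f2 : S.
Variables u1 u2 v1 v2 : S.
Hypothesis ux : x = u1 * f1 + u2 * f2.
Hypothesis vy : y = v1 * f1 + v2 * f2.

(** The ideal [(f1, f2)] contains the regular sequence [x, y]. Contracting the cycle with [u] gives
    [t] whose boundary is [x] times the cycle; contracting with [v] shows that [y * t], hence [t],
    is divisible by [x], and [x] cancels. *)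
Lemma koszul2_exact c1 c2 : c1 * f1 + c2 * f2 = 0 ->
  exists h, c1 = h * f2 /\ c2 = - (h * f1).
Proof.
move=> cf; pose t := u2 * c1 - u1 * c2.
have e1 : x * c1 = t * f2.
  have: x * c1 - t * f2 = u1 * (c1 * f1 + c2 * f2) by rewrite ux /t; ring.
  by rewrite cf mulr0 => /subr0_eq.
have e2 : x * c2 = - (t * f1).
  have: x * c2 - - (t * f1) = u2 * (c1 * f1 + c2 * f2) by rewrite ux /t; ring.
  by rewrite cf mulr0 => /subr0_eq.
have [h th] : exists h, t = x * h.
  apply: (regy (p := v2 * c1 - v1 * c2)).
  have: y * t - x * (v2 * c1 - v1 * c2) = v1 * (t * f1 + x * c2) + v2 * (t * f2 - x * c1).
    by rewrite vy; ring.
  by rewrite e1 e2 subrr addrN !mulr0 addr0 => /subr0_eq.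
exists h; split; apply/subr0_eq/regx.
  by rewrite mulrBr e1 th; ring.
by rewrite mulrBr e2 th; ring.
Qed.

End Koszul2.

Section Koszul3.
Variables (S : comNzRingType) (x y w : S).
Hypothesis regx : forall s, x * s = 0 -> s = 0.
Hypothesis regy : forall s p, y * s = x * p -> exists q, s = x * q.
Hypothesis regw : forall s p q, w * s = x * p + y * q ->
  exists p' q', s = x * p' + y * q'.
Variables f1 f2 f3 : S.
Variables u1 u2 u3 v1 v2 v3 t1 t2 t3 : S.
Hypothesis ux : x = u1 * f1 + u2 * f2 + u3 * f3.
Hypothesis vy : y = v1 * f1 + v2 * f2 + v3 * f3.
Hypothesis tw : w = t1 * f1 + t2 * f2 + t3 * f3.

Let regxI a b : x * a = x * b -> a = b.
Proof. by move=> e; apply/subr0_eq/regx; rewrite mulrBr e subrr. Qed.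

(** In vector notation, [f x h = 0] implies [h = s f]. Contraction with [u] gives [x h = t f] where
    [t = u . h], and then [y t = x (v . h)] forces [x] to divide [t]. *)
Lemma koszul3_exact2 h1 h2 h3 :
  f2 * h3 - f3 * h2 = 0 -> f3 * h1 - f1 * h3 = 0 -> f1 * h2 - f2 * h1 = 0 ->
  exists s, [/\ h1 = s * f1, h2 = s * f2 & h3 = s * f3].
Proof.
move=> e1 e2 e3; pose t := u1 * h1 + u2 * h2 + u3 * h3.
have x1 : x * h1 = t * f1.
  have: x * h1 - t * f1 = u3 * (f3 * h1 - f1 * h3) - u2 * (f1 * h2 - f2 * h1).
    by rewrite ux /t; ring.
  by rewrite e2 e3 !mulr0 subr0 => /subr0_eq.
have x2 : x * h2 = t * f2.
  have: x * h2 - t * f2 = u1 * (f1 * h2 - f2 * h1) - u3 * (f2 * h3 - f3 * h2).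
    by rewrite ux /t; ring.
  by rewrite e1 e3 !mulr0 subr0 => /subr0_eq.
have x3 : x * h3 = t * f3.
  have: x * h3 - t * f3 = u2 * (f2 * h3 - f3 * h2) - u1 * (f3 * h1 - f1 * h3).
    by rewrite ux /t; ring.
  by rewrite e1 e2 !mulr0 subr0 => /subr0_eq.
have [s ts] : exists s, t = x * s.
  apply: (regy (p := v1 * h1 + v2 * h2 + v3 * h3)).
  have -> : y * t = v1 * (t * f1) + v2 * (t * f2) + v3 * (t * f3).
    by rewrite vy; ring.
  by rewrite -x1 -x2 -x3; ring.
by exists s; split; apply: regxI; rewrite ?x1 ?x2 ?x3 ts; ring.
Qed.

(* Modulo x the sequence f has lost one degree of depth, but y and w remain. *)
Let koszul3_mod h1 h2 h3 a1 a2 a3 :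
  f2 * h3 - f3 * h2 = x * a1 -> f3 * h1 - f1 * h3 = x * a2 ->
  f1 * h2 - f2 * h1 = x * a3 ->
  exists q g1 g2 g3,
    [/\ h1 = q * f1 + x * g1, h2 = q * f2 + x * g2 & h3 = q * f3 + x * g3].
Proof.
move=> e1 e2 e3; pose t := v1 * h1 + v2 * h2 + v3 * h3.
have y1 : y * h1 = t * f1 + x * (v3 * a2 - v2 * a3).
  have: y * h1 - t * f1 = v3 * (f3 * h1 - f1 * h3) - v2 * (f1 * h2 - f2 * h1).
    by rewrite vy /t; ring.
  by rewrite e2 e3 => /(canRL (subrK _)) ->; ring.
have y2 : y * h2 = t * f2 + x * (v1 * a3 - v3 * a1).
  have: y * h2 - t * f2 = v1 * (f1 * h2 - f2 * h1) - v3 * (f2 * h3 - f3 * h2).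
    by rewrite vy /t; ring.
  by rewrite e1 e3 => /(canRL (subrK _)) ->; ring.
have y3 : y * h3 = t * f3 + x * (v2 * a1 - v1 * a2).
  have: y * h3 - t * f3 = v2 * (f2 * h3 - f3 * h2) - v1 * (f3 * h1 - f1 * h3).
    by rewrite vy /t; ring.
  by rewrite e1 e2 => /(canRL (subrK _)) ->; ring.
(* Contraction of the three relations with the [ti] puts [w * t] in [(x, y)], and [w] is regular
   modulo that ideal. *)
have [p [q tpq]] : exists p q, t = x * p + y * q.
  pose b1 := v3 * a2 - v2 * a3; pose b2 := v1 * a3 - v3 * a1.
  pose b3 := v2 * a1 - v1 * a2.
  apply: (regw (p := - (t1 * b1 + t2 * b2 + t3 * b3))
               (q := t1 * h1 + t2 * h2 + t3 * h3)).
  rewrite -/b1 in y1; rewrite -/b2 in y2; rewrite -/b3 in y3.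
  have -> : w * t = t1 * (t * f1) + t2 * (t * f2) + t3 * (t * f3).
    by rewrite tw; ring.
  rewrite (canRL (addrK _) (esym y1)) (canRL (addrK _) (esym y2)).
  by rewrite (canRL (addrK _) (esym y3)); ring.
have lift h f b : y * h = t * f + x * b -> exists g, h = q * f + x * g.
  move=> e; have [g hg] : exists g, h - q * f = x * g.
    apply: (regy (p := p * f + b)); rewrite mulrBr e tpq; ring.
  by exists g; rewrite -hg addrC subrK.
have [g1 ?] := lift _ _ _ y1; have [g2 ?] := lift _ _ _ y2.
have [g3 ?] := lift _ _ _ y3.
by exists q, g1, g2, g3.
Qed.

(** For [c . f = 0] and [k = c x u], the triple product formula gives [f x k = x c]. Modulo [x] the
    vector [k] is then a multiple of [f], which [f x _] kills, so [f x k] is [x] times some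
    [f x g]. *)
Lemma koszul3_exact1 c1 c2 c3 : c1 * f1 + c2 * f2 + c3 * f3 = 0 ->
  exists h1 h2 h3, [/\ c1 = f2 * h3 - f3 * h2, c2 = f3 * h1 - f1 * h3
                     & c3 = f1 * h2 - f2 * h1].
Proof.
move=> cf.
pose k1 := c2 * u3 - c3 * u2; pose k2 := c3 * u1 - c1 * u3.
pose k3 := c1 * u2 - c2 * u1.
have e1 : f2 * k3 - f3 * k2 = x * c1.
  have: x * c1 - (f2 * k3 - f3 * k2) = u1 * (c1 * f1 + c2 * f2 + c3 * f3).
    by rewrite ux /k2 /k3; ring.
  by rewrite cf mulr0 => /subr0_eq.
have e2 : f3 * k1 - f1 * k3 = x * c2.
  have: x * c2 - (f3 * k1 - f1 * k3) = u2 * (c1 * f1 + c2 * f2 + c3 * f3).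
    by rewrite ux /k1 /k3; ring.
  by rewrite cf mulr0 => /subr0_eq.
have e3 : f1 * k2 - f2 * k1 = x * c3.
  have: x * c3 - (f1 * k2 - f2 * k1) = u3 * (c1 * f1 + c2 * f2 + c3 * f3).
    by rewrite ux /k1 /k2; ring.
  by rewrite cf mulr0 => /subr0_eq.
have [q [g1 [g2 [g3 [E1 E2 E3]]]]] := koszul3_mod e1 e2 e3.
exists g1, g2, g3; split; apply: regxI.
- by rewrite -e1 E2 E3; ring.
- by rewrite -e2 E1 E3; ring.
by rewrite -e3 E1 E2; ring.
Qed.

End Koszul3.

Section Wiebe2.
Variables (S : comNzRingType) (z1 z2 f1 f2 : S).
Hypothesis regz1 : forall s, z1 * s = 0 -> s = 0.
Hypothesis kosz : forall c1 c2, c1 * z1 + c2 * z2 = 0 ->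
  exists h, c1 = h * z2 /\ c2 = - (h * z1).
Hypothesis kosf : forall c1 c2, c1 * f1 + c2 * f2 = 0 ->
  exists h, c1 = h * f2 /\ c2 = - (h * f1).
Variables a11 a12 a21 a22 : S.
Hypothesis fz1 : f1 = a11 * z1 + a12 * z2.
Hypothesis fz2 : f2 = a21 * z1 + a22 * z2.

(* Two and three variables of Wiebe's theorem: (f : z) = f + (det A). *)
Lemma wiebe2 g c11 c12 c21 c22 :
  g * z1 = c11 * f1 + c12 * f2 -> g * z2 = c21 * f1 + c22 * f2 ->
  exists s q1 q2, g = s * (a11 * a22 - a12 * a21) + (q1 * f1 + q2 * f2).
Proof.
move=> g1 g2.
(* The identity [z2 (g z1) = z1 (g z2)] is a syzygy of [(f1, f2)]; its Koszul coefficient [h]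
   becomes the multiplier of [det A]. *)
have [|h [h1 h2]] := kosf (c1 := z2 * c11 - z1 * c21) (c2 := z2 * c12 - z1 * c22).
  transitivity (z2 * (c11 * f1 + c12 * f2) - z1 * (c21 * f1 + c22 * f2)).
    by ring.
  by rewrite -g1 -g2; ring.
have [|q1 [_ e1]] := kosz (c1 := - (c21 + h * a21)) (c2 := c11 - h * a22).
  transitivity (z2 * c11 - z1 * c21 - h * (a21 * z1 + a22 * z2)); first by ring.
  by rewrite h1 -fz2 subrr.
have [|q2 [_ e2]] := kosz (c1 := - (c22 - h * a11)) (c2 := c12 + h * a12).
  transitivity (z2 * c12 - z1 * c22 + h * (a11 * z1 + a12 * z2)); first by ring.
  by rewrite h2 -fz1 addNr.
exists h, (- q1), (- q2); apply/subr0_eq/regz1; rewrite mulrBr (mulrC z1) g1.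
rewrite (canRL (subrK _) e1) (canRL (addrK _) e2) fz1 fz2; ring.
Qed.

End Wiebe2.

Section Wiebe3.
Variables (S : comNzRingType) (z1 z2 z3 f1 f2 f3 : S).
Hypothesis regz1 : forall s, z1 * s = 0 -> s = 0.

Definition koszul3_acyclic (y1 y2 y3 : S) :=
  (forall h1 h2 h3,
    y2 * h3 - y3 * h2 = 0 -> y3 * h1 - y1 * h3 = 0 -> y1 * h2 - y2 * h1 = 0 ->
    exists s, [/\ h1 = s * y1, h2 = s * y2 & h3 = s * y3]) /\
  (forall c1 c2 c3, c1 * y1 + c2 * y2 + c3 * y3 = 0 ->
    exists h1 h2 h3, [/\ c1 = y2 * h3 - y3 * h2, c2 = y3 * h1 - y1 * h3
                       & c3 = y1 * h2 - y2 * h1]).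

Hypothesis kosz : koszul3_acyclic z1 z2 z3.
Hypothesis kosf : koszul3_acyclic f1 f2 f3.
Variables a11 a12 a13 a21 a22 a23 a31 a32 a33 : S.
Hypothesis fz1 : f1 = a11 * z1 + a12 * z2 + a13 * z3.
Hypothesis fz2 : f2 = a21 * z1 + a22 * z2 + a23 * z3.
Hypothesis fz3 : f3 = a31 * z1 + a32 * z2 + a33 * z3.

(** A zigzag through the double complex built from the two Koszul complexes: exactness for [f] leads
    from the [c] to the [h] and to the scalar [s], then exactness for [z] leads back through the [p]
    to the [q]. *)
Lemma wiebe3 g c11 c12 c13 c21 c22 c23 c31 c32 c33 :
  g * z1 = c11 * f1 + c12 * f2 + c13 * f3 ->
  g * z2 = c21 * f1 + c22 * f2 + c23 * f3 ->
  g * z3 = c31 * f1 + c32 * f2 + c33 * f3 ->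
  exists s q1 q2 q3,
    g = s * (a11 * (a22 * a33 - a32 * a23) + a21 * (a32 * a13 - a12 * a33)
             + a31 * (a12 * a23 - a22 * a13))
        + (q1 * f1 + q2 * f2 + q3 * f3).
Proof.
move=> g1 g2 g3; case: kosf kosz => [kf2 kf1] [kz2 kz1].
have syz i j (ci1 ci2 ci3 cj1 cj2 cj3 : S) :
    g * i = ci1 * f1 + ci2 * f2 + ci3 * f3 ->
    g * j = cj1 * f1 + cj2 * f2 + cj3 * f3 ->
    (j * ci1 - i * cj1) * f1 + (j * ci2 - i * cj2) * f2
      + (j * ci3 - i * cj3) * f3 = 0.
  move=> ei ej; transitivity (j * (g * i) - i * (g * j)); last by ring.
  by rewrite ei ej; ring.
have [h11 [h12 [h13 [E11 E12 E13]]]] := kf1 _ _ _ (syz _ _ _ _ _ _ _ _ g2 g3).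
have [h21 [h22 [h23 [E21 E22 E23]]]] := kf1 _ _ _ (syz _ _ _ _ _ _ _ _ g3 g1).
have [h31 [h32 [h33 [E31 E32 E33]]]] := kf1 _ _ _ (syz _ _ _ _ _ _ _ _ g1 g2).
have [||| s [s1 s2 s3]] := kf2 (z1 * h11 + z2 * h21 + z3 * h31)
  (z1 * h12 + z2 * h22 + z3 * h32) (z1 * h13 + z2 * h23 + z3 * h33).
- transitivity (z1 * (f2 * h13 - f3 * h12) + z2 * (f2 * h23 - f3 * h22)
               + z3 * (f2 * h33 - f3 * h32)); first by ring.
  by rewrite -E11 -E21 -E31; ring.
- transitivity (z1 * (f3 * h11 - f1 * h13) + z2 * (f3 * h21 - f1 * h23)
               + z3 * (f3 * h31 - f1 * h33)); first by ring.
  by rewrite -E12 -E22 -E32; ring.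
- transitivity (z1 * (f1 * h12 - f2 * h11) + z2 * (f1 * h22 - f2 * h21)
               + z3 * (f1 * h32 - f2 * h31)); first by ring.
  by rewrite -E13 -E23 -E33; ring.
have diff i (h1 h2 h3 a1 a2 a3 : S) : i = a1 * z1 + a2 * z2 + a3 * z3 ->
    z1 * h1 + z2 * h2 + z3 * h3 = s * i ->
    (h1 - s * a1) * z1 + (h2 - s * a2) * z2 + (h3 - s * a3) * z3 = 0.
  move=> ei eh; transitivity (z1 * h1 + z2 * h2 + z3 * h3 - s * i).
    by rewrite ei; ring.
  by rewrite eh subrr.
have [p11 [p21 [p31 [P11 P12 P13]]]] := kz1 _ _ _ (diff _ _ _ _ _ _ _ fz1 s1).
have [p12 [p22 [p32 [P21 P22 P23]]]] := kz1 _ _ _ (diff _ _ _ _ _ _ _ fz2 s2).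
have [p13 [p23 [p33 [P31 P32 P33]]]] := kz1 _ _ _ (diff _ _ _ _ _ _ _ fz3 s3).
have {P11} H11 := canRL (subrK _) P11; have {P12} H21 := canRL (subrK _) P12.
have {P13} H31 := canRL (subrK _) P13; have {P21} H12 := canRL (subrK _) P21.
have {P22} H22 := canRL (subrK _) P22; have {P23} H32 := canRL (subrK _) P23.
have {P31} H13 := canRL (subrK _) P31; have {P32} H23 := canRL (subrK _) P32.
have {P33} H33 := canRL (subrK _) P33.
(* The factors of [s] are the entries of the adjugate of [A]. They make each column
   [(e1j, e2j, e3j)] satisfy [z x e = 0], so that it is a multiple [qj] of [z]. *)
pose e11 := c11 - s * (a22 * a33 - a32 * a23) + (f2 * p13 - f3 * p12).
pose e12 := c12 - s * (a32 * a13 - a12 * a33) + (f3 * p11 - f1 * p13).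
pose e13 := c13 - s * (a12 * a23 - a22 * a13) + (f1 * p12 - f2 * p11).
pose e21 := c21 - s * (a23 * a31 - a33 * a21) + (f2 * p23 - f3 * p22).
pose e22 := c22 - s * (a33 * a11 - a13 * a31) + (f3 * p21 - f1 * p23).
pose e23 := c23 - s * (a13 * a21 - a23 * a11) + (f1 * p22 - f2 * p21).
pose e31 := c31 - s * (a21 * a32 - a31 * a22) + (f2 * p33 - f3 * p32).
pose e32 := c32 - s * (a31 * a12 - a11 * a32) + (f3 * p31 - f1 * p33).
pose e33 := c33 - s * (a11 * a22 - a21 * a12) + (f1 * p32 - f2 * p31).
have [||| q1 [Q11 Q21 Q31]] := kz2 e11 e21 e31.
- transitivity (- (z3 * c21 - z2 * c31) + z2 * (e31 - c31) - z3 * (e21 - c21)).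
    by ring.
  by rewrite E11 H12 H13 /e31 /e21 fz2 fz3; ring.
- transitivity (- (z1 * c31 - z3 * c11) + z3 * (e11 - c11) - z1 * (e31 - c31)).
    by ring.
  by rewrite E21 H22 H23 /e31 /e11 fz2 fz3; ring.
- transitivity (- (z2 * c11 - z1 * c21) + z1 * (e21 - c21) - z2 * (e11 - c11)).
    by ring.
  by rewrite E31 H32 H33 /e21 /e11 fz2 fz3; ring.
have [||| q2 [Q12 Q22 Q32]] := kz2 e12 e22 e32.
- transitivity (- (z3 * c22 - z2 * c32) + z2 * (e32 - c32) - z3 * (e22 - c22)).
    by ring.
  by rewrite E12 H11 H13 /e32 /e22 fz1 fz3; ring.
- transitivity (- (z1 * c32 - z3 * c12) + z3 * (e12 - c12) - z1 * (e32 - c32)).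
    by ring.
  by rewrite E22 H21 H23 /e32 /e12 fz1 fz3; ring.
- transitivity (- (z2 * c12 - z1 * c22) + z1 * (e22 - c22) - z2 * (e12 - c12)).
    by ring.
  by rewrite E32 H31 H33 /e22 /e12 fz1 fz3; ring.
have [||| q3 [Q13 Q23 Q33]] := kz2 e13 e23 e33.
- transitivity (- (z3 * c23 - z2 * c33) + z2 * (e33 - c33) - z3 * (e23 - c23)).
    by ring.
  by rewrite E13 H11 H12 /e33 /e23 fz1 fz2; ring.
- transitivity (- (z1 * c33 - z3 * c13) + z3 * (e13 - c13) - z1 * (e33 - c33)).
    by ring.
  by rewrite E23 H21 H22 /e33 /e13 fz1 fz2; ring.
- transitivity (- (z2 * c13 - z1 * c23) + z1 * (e23 - c23) - z2 * (e13 - c13)).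
    by ring.
  by rewrite E33 H31 H32 /e23 /e13 fz1 fz2; ring.
exists s, q1, q2, q3; apply/subr0_eq/regz1; rewrite mulrBr (mulrC z1) g1.
transitivity (f1 * (e11 - q1 * z1) + f2 * (e12 - q2 * z1) + f3 * (e13 - q3 * z1)).
  rewrite /e11 /e12 /e13; set X := _ - z1 * _.
  have -> : X = c11 * f1 + c12 * f2 + c13 * f3
    - s * ((a22 * a33 - a32 * a23) * (a11 * z1) + (a32 * a13 - a12 * a33) * (a21 * z1)
        + (a12 * a23 - a22 * a13) * (a31 * z1)) - z1 * (q1 * f1 + q2 * f2 + q3 * f3).
    by rewrite /X; ring.
  rewrite (canRL (addrK _) (canRL (addrK _) (esym fz1))).
  rewrite (canRL (addrK _) (canRL (addrK _) (esym fz2))).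
  by rewrite (canRL (addrK _) (canRL (addrK _) (esym fz3))); ring.
by rewrite Q11 Q12 Q13; ring.
Qed.

End Wiebe3.

(** * Powers of the variables form a regular sequence *)

Section VariablePowers.
Variables (K : fieldType) (n k : nat).
Implicit Types (p q s : {mpoly K[n]}) (i j l : 'I_n).

Lemma mcoeff_mulXn_neq0 i p m : ('X_i ^+ k * p)@_m != 0 -> (k <= m i)%N.
Proof.
rewrite -mcoeff_msupp mulrC mpolyXn (perm_mem (msuppMX _ _)) => /mapP[m' _ ->].
by rewrite mnmDE mulmnE mnm1E eqxx mul1n leq_addr.
Qed.

Lemma mcoeff_mulXn i p m : ('X_i ^+ k * p)@_(U_(i) *+ k + m) = p@_m.
Proof. by rewrite mulrC mpolyXn mcoeffMX. Qed.

Lemma mulXn_inj i s : 'X_i ^+ k * s = 0 -> s = 0.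
Proof.
by move=> e; apply/mpolyP => m; rewrite -(mcoeff_mulXn i) e !mcoeff0.
Qed.

Lemma mpolyX_factor i (m : 'X_{1..n}) : (k <= m i)%N ->
  'X_[m] = 'X_i ^+ k * 'X_[m - U_(i) *+ k] :> {mpoly K[n]}.
Proof.
move=> km; rewrite mpolyXn -mpolyXD; congr 'X_[_]; apply/mnmP => j.
rewrite mnmDE mnmBE mulmnE mnm1E; case: eqP => [<-|_].
  by rewrite mul1n subnKC.
by rewrite mul0n add0n subn0.
Qed.

Lemma mulXn2_ideal i j s :
  {in msupp s, forall m : 'X_{1..n}, (k <= m i)%N || (k <= m j)%N} ->
  exists p q, s = 'X_i ^+ k * p + 'X_j ^+ k * q.
Proof.
rewrite {2}(mpolyE s); elim: (msupp s) => [|m r IH] h.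
  by exists 0, 0; rewrite big_nil !mulr0 addr0.
have [|p [q e]] := IH; first by move=> m' hm'; apply: h; rewrite inE hm' orbT.
rewrite big_cons e; have /orP[hm|hm] := h m (mem_head _ _).
  exists (s@_m *: 'X_[m - U_(i) *+ k] + p), q.
  by rewrite (mpolyX_factor hm) mulrDr scalerAr addrA.
exists p, (s@_m *: 'X_[m - U_(j) *+ k] + q).
by rewrite (mpolyX_factor hm) mulrDr scalerAr addrCA.
Qed.

(** Membership in a monomial ideal is read off the support, and multiplication by a power of [X_j]
    leaves the exponents of [X_i] unchanged. *)
Lemma Xn_regular2 i j s p : i != j ->
  'X_j ^+ k * s = 'X_i ^+ k * p -> exists q, s = 'X_i ^+ k * q.
Proof.
(* Taking both variables equal in [mulXn2_ideal] yields divisibility by [X_i ^ k]. *)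
move=> ij e; have [m hm|p1 [q1 ->]] := @mulXn2_ideal i i s.
  have : ('X_i ^+ k * p)@_(U_(j) *+ k + m) != 0.
    by rewrite -e mcoeff_mulXn -mcoeff_msupp.
  move=> /mcoeff_mulXn_neq0; rewrite mnmDE mulmnE mnm1E eq_sym (negPf ij).
  by rewrite mul0n add0n => ->.
by exists (p1 + q1); rewrite mulrDr.
Qed.

Lemma Xn_regular3 i j l s p q : i != l -> j != l ->
  'X_l ^+ k * s = 'X_i ^+ k * p + 'X_j ^+ k * q ->
  exists p' q', s = 'X_i ^+ k * p' + 'X_j ^+ k * q'.
Proof.
move=> il jl e; apply: mulXn2_ideal => m hm.
have : ('X_i ^+ k * p + 'X_j ^+ k * q)@_(U_(l) *+ k + m) != 0.
  by rewrite -e mcoeff_mulXn -mcoeff_msupp.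
have mE t : t != l -> (U_(l) *+ k + m)%MM t = m t.
  by move=> tl; rewrite mnmDE mulmnE mnm1E eq_sym (negPf tl) mul0n.
rewrite mcoeffD -(mE i il) -(mE j jl).
have [/eqP ->|/mcoeff_mulXn_neq0 -> //] := boolP (('X_i ^+ k * p)@_(U_(l) *+ k + m) == 0).
by rewrite add0r => /mcoeff_mulXn_neq0 ->; rewrite orbT.
Qed.

End VariablePowers.

(** Entries are indexed by [nat] so that the ordinals produced by the cofactor expansion reduce to
    numerals. *)
Lemma det_mx22 (S : comNzRingType) (B : nat -> nat -> S) :
  \det (\matrix_(i < 2, j < 2) B i j) = B 0 0 * B 1 1 - B 0 1 * B 1 0.
Proof.
rewrite (expand_det_row _ ord0) !big_ord_recl big_ord0 /cofactor !det_mx11 !mxE.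
by rewrite /= /bump /=; ring.
Qed.

Lemma det_mx33 (S : comNzRingType) (B : nat -> nat -> S) :
  \det (\matrix_(i < 3, j < 3) B i j) =
  B 0 0 * (B 1 1 * B 2 2 - B 2 1 * B 1 2)
  + B 1 0 * (B 2 1 * B 0 2 - B 0 1 * B 2 2)
  + B 2 0 * (B 0 1 * B 1 2 - B 1 1 * B 0 2).
Proof.
rewrite (expand_det_row _ ord0) !big_ord_recl big_ord0 /cofactor.
rewrite !(expand_det_row _ ord0) !big_ord_recl !big_ord0 /cofactor !det_mx11 !mxE.
by rewrite /= /bump /=; ring.
Qed.
Lemma matrix_nat (T : Type) n (A : 'M[T]_n.+1) :
  A = \matrix_(i, j) A (inord i) (inord j).
Proof. by apply/matrixP => i j; rewrite mxE !inord_val. Qed.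

Definition in_ideal (S : comNzRingType) n (f : 'I_n -> S) (g : S) :=
  exists a : 'I_n -> S, g = \sum_i a i * f i.

(** The nontrivial inclusion of [(f : z) = f + (det A)] for a sequence [f] whose ideal contains
    powers of all variables. It is kept as a property of [n], so that the study of the Jacobian
    ideal can be uniform in [n]. *)
Definition socle_in_det (K : fieldType) n :=
  forall (f : 'I_n -> {mpoly K[n]}) (A : 'M[{mpoly K[n]}]_n) k,
    (forall i, f i = \sum_j A i j * 'X_j) ->
    (forall j, in_ideal f ('X_j ^+ k)) ->
    forall g, (forall j, in_ideal f (g * 'X_j)) ->
    exists s, in_ideal f (g - s * \det A).

Lemma socle_in_det2 (K : fieldType) : socle_in_det K 2.
Proof.
move=> f A k fA fX g gX.
pose i0 : 'I_2 := inord 0; pose i1 : 'I_2 := inord 1.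
have i01 : i0 != i1 by rewrite -val_eqE /= !inordK.
have sumE (F : 'I_2 -> {mpoly K[2]}) : \sum_i F i = F i0 + F i1.
  rewrite !big_ord_recl big_ord0 addr0; congr (F _ + F _); apply: val_inj;
  by rewrite /= inordK.
have [u ux] := fX i0; have [v vy] := fX i1; rewrite !sumE in ux vy.
have kosf c1 c2 := koszul2_exact (c1 := c1) (c2 := c2)
  (@mulXn_inj K 2 k i0) (fun s p => @Xn_regular2 K 2 k i0 i1 s p i01) ux vy.
have kosz c1 c2 : c1 * 'X_i0 + c2 * 'X_i1 = 0 ->
    exists h : {mpoly K[2]}, c1 = h * 'X_i1 /\ c2 = - (h * 'X_i0).
  apply: (koszul2_exact (u1 := 1) (u2 := 0) (v1 := 0) (v2 := 1)
   (@mulXn_inj K 2 1 i0) (fun s p => @Xn_regular2 K 2 1 i0 i1 s p i01)).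
    by rewrite expr1 mul1r mul0r addr0.
  by rewrite expr1 mul1r mul0r add0r.
have [c1 e1] := gX i0; have [c2 e2] := gX i1; rewrite !sumE in e1 e2.
have f0 := fA i0; have f1 := fA i1; rewrite !sumE in f0 f1.
have [s [q1 [q2 e]]] := wiebe2 (@mulXn_inj K 2 1 i0) kosz kosf f0 f1 e1 e2.
exists s, (fun i => if i == i0 then q1 else q2); rewrite sumE /=.
rewrite eqxx eq_sym (negPf i01) [A]matrix_nat.
by rewrite (det_mx22 (fun i j => A (inord i) (inord j))) e addrAC subrr add0r.
Qed.

Lemma socle_in_det3 (K : fieldType) : socle_in_det K 3.
Proof.
move=> f A k fA fX g gX.
pose i0 : 'I_3 := inord 0; pose i1 : 'I_3 := inord 1; pose i2 : 'I_3 := inord 2.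
have i01 : i0 != i1 by rewrite -val_eqE /= !inordK.
have i02 : i0 != i2 by rewrite -val_eqE /= !inordK.
have i12 : i1 != i2 by rewrite -val_eqE /= !inordK.
have sumE (F : 'I_3 -> {mpoly K[3]}) : \sum_i F i = F i0 + F i1 + F i2.
  rewrite !big_ord_recl big_ord0 addr0 addrA.
  by congr (F _ + F _ + F _); apply: val_inj; rewrite /= inordK.
have reg2 k' s p := @Xn_regular2 K 3 k' i0 i1 s p i01.
have reg3 k' s p q := @Xn_regular3 K 3 k' i0 i1 i2 s p q i02 i12.
have acyc (y1 y2 y3 : {mpoly K[3]}) k' u1 u2 u3 v1 v2 v3 t1 t2 t3 :
    'X_i0 ^+ k' = u1 * y1 + u2 * y2 + u3 * y3 ->
    'X_i1 ^+ k' = v1 * y1 + v2 * y2 + v3 * y3 ->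
    'X_i2 ^+ k' = t1 * y1 + t2 * y2 + t3 * y3 -> koszul3_acyclic y1 y2 y3.
  move=> eu ev et; split=> [h1 h2 h3|c1 c2 c3].
    exact: (koszul3_exact2 (@mulXn_inj K 3 k' i0) (reg2 k') eu ev).
  exact: (koszul3_exact1 (@mulXn_inj K 3 k' i0) (reg2 k') (reg3 k') eu ev et).
have [u ux] := fX i0; have [v vy] := fX i1; have [t tw] := fX i2.
rewrite !sumE in ux vy tw; have kosf := acyc _ _ _ _ _ _ _ _ _ _ _ _ _ ux vy tw.
have kosz : koszul3_acyclic ('X_i0 : {mpoly K[3]}) 'X_i1 'X_i2.
  apply: (acyc _ _ _ 1 1 0 0 0 1 0 0 0 1).
  - by rewrite expr1 mul1r !mul0r !addr0.
  - by rewrite expr1 mul1r !mul0r !addr0 add0r.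
  - by rewrite expr1 mul1r !mul0r !add0r.
have [c1 e1] := gX i0; have [c2 e2] := gX i1; have [c3 e3] := gX i2.
rewrite !sumE in e1 e2 e3.
have f0 := fA i0; have f1 := fA i1; have f2 := fA i2; rewrite !sumE in f0 f1 f2.
have [s [q1 [q2 [q3 e]]]] :=
  wiebe3 (@mulXn_inj K 3 1 i0) kosz kosf f0 f1 f2 e1 e2 e3.
exists s, (fun i => if i == i0 then q1 else if i == i1 then q2 else q3).
rewrite sumE /= eqxx (eq_sym i1) (negPf i01) eqxx (eq_sym i2) (negPf i02).
rewrite (eq_sym i2) (negPf i12) [A]matrix_nat.
by rewrite (det_mx33 (fun i j => A (inord i) (inord j))) e addrAC subrr add0r.
Qed.

(** * Nullstellensatz over an uncountable field *)

Section Uncountable.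
Import Order.TTheory Num.Theory.

(** Nested intervals: [step n] keeps an outer third of the interval that avoids [u n]. The supremum
    of the left ends lies in every interval, although it is itself a value of [u]. *)
Lemma uncountable_realType (R : realType) : ~ countable [set: R].
Proof.
move=> /countable_injP[f]; pose u := 'pinv_(fun=> 0) [set: R] f.
move=> finj; have uf x : u (f x) = x by exact: (pinvKV _ finj (in_setT x)).
pose step (n : nat) (ab : R * R) :=
  if u n < (ab.1 + 2 * ab.2) / 3 then ((ab.1 + 2 * ab.2) / 3, ab.2)
  else (ab.1, (2 * ab.1 + ab.2) / 3).
pose I := fix I n := if n is n'.+1 then step n' (I n') else (0, 1).
have Ilt n : (I n).1 < (I n).2.
  elim: n => [|n IH] /=; first exact: ltr01.
  by rewrite /step; case: ifP => _ /=; lra.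
have Isub n : (I n).1 <= (I n.+1).1 /\ (I n.+1).2 <= (I n).2.
  by have := Ilt n; rewrite /= /step; case: ifP => _ /=; lra.
have Ile n k : (I n).1 <= (I (n + k)%N).1 /\ (I (n + k)%N).2 <= (I n).2.
  elim: k => [|k [IH1 IH2]]; first by rewrite addn0.
  rewrite addnS; have [J1 J2] := Isub (n + k)%N.
  by split; [exact: le_trans J1|exact: le_trans J2 _].
have Iub n m : (I n).1 <= (I m).2.
  have [nm|/ltnW nm] := leqP n m; rewrite -(subnKC nm).
    by apply: le_trans (ltW (Ilt _)); case: (Ile n (m - n)%N).
  by apply: le_trans (ltW (Ilt _)) _; case: (Ile m (n - m)%N).
pose A := [set (I n).1 | n in [set: nat]].
have Aub m : ubound A (I m).2 by move=> _ [n _ <-].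
have A0 : A !=set0 by exists (I 0).1; exists 0%N.
have lex n : (I n).1 <= sup A.
  by apply: ub_le_sup; [exists (I 0).2; exact: Aub|exists n].
have gex n : sup A <= (I n).2 by apply: ge_sup.
have := lex (f (sup A)).+1; have := gex (f (sup A)).+1.
rewrite /= /step uf; have := Ilt (f (sup A)).
by case: ifPn => /=; rewrite -?leNgt; lra.
Qed.

Lemma uncountable_complex (R : realType) : ~ countable [set: R[i]].
Proof.
move=> /countable_injP[f finj]; apply: (@uncountable_realType R).
apply/countable_injP; exists (f \o (fun x => x%:C%C)) => x y _ _ /= e.
by have /(_ (in_setT _) (in_setT _) e) [] := finj x%:C%C y%:C%C.
Qed.

End Uncountable.

Definition ideal_pred (S : comNzRingType) (I : S -> Prop) :=
  [/\ I 0, forall x y, I x -> I y -> I (x + y) & forall a x, I x -> I (a * x)].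

Section Ideals.
Variables (S : comNzRingType) (I : S -> Prop).
Hypothesis idI : ideal_pred I.

Lemma ideal_sum J (r : seq J) (P : pred J) (F : J -> S) :
  (forall j, P j -> I (F j)) -> I (\sum_(j <- r | P j) F j).
Proof. by case: idI => I0 ID _ h; elim/big_ind: _. Qed.

Lemma idealB x y : I x -> I y -> I (x - y).
Proof. by case: idI => _ ID IM hx hy; apply: ID => //; rewrite -mulN1r; apply: IM. Qed.

Definition ideal_adjoin z := fun x : S => exists a u, I u /\ x = u + a * z.

Lemma ideal_adjoinP z : ideal_pred (ideal_adjoin z).
Proof.
case: idI => I0 ID IM; split.
- by exists 0, 0; rewrite mul0r addr0.
- move=> _ _ [a [u [hu ->]]] [b [v [hv ->]]]; exists (a + b), (u + v).
  by split; [exact: ID|ring].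
move=> c _ [a [u [hu ->]]]; exists (c * a), (c * u).
by split; [exact: IM|ring].
Qed.

Lemma sub_ideal_adjoin z x : I x -> ideal_adjoin z x.
Proof. by move=> hx; exists 0, x; rewrite mul0r addr0. Qed.

Lemma mem_ideal_adjoin z : ideal_adjoin z z.
Proof. by case: idI => I0 _ _; exists 1, 0; rewrite add0r mul1r. Qed.

End Ideals.

Section Nullstellensatz.
Variables (K : closedFieldType) (n : nat).
Hypothesis uncountableK : ~ countable [set: K].
Local Notation S := {mpoly K[n]}.
Variable I : S -> Prop.
Hypothesis idI : ideal_pred I.
Hypothesis I1 : ~ I 1.

(* If every z - lam were invertible modulo I, then uncountably many of the
   inverses would have bounded degree, and a linear relation between them would
   give a nonzero univariate polynomial p with p(z) in I; but p splits. *)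
Lemma ideal_adjoin_proper (z : S) : exists lam, ~ ideal_adjoin I (z - lam%:MP) 1.
Proof.
case: (idI) => I0 ID IM; apply: contrapT => /forallNP noninv.
have /choice[h hP] : forall lam, exists h, I (1 - h * (z - lam%:MP)).
  move=> lam; have /contrapT [a [u [hu e]]] := noninv lam.
  by exists a; rewrite e addrK.
pose ev (p : {poly K}) : S := (map_poly (@mpolyC n K) p).[z].
(* Since [z - mu] is invertible modulo [I], it can be cancelled there; this removes the linear
   factors of [p] one by one. *)
have invP a mu : I (a * (z - mu%:MP)) -> I a.
  move=> ha; have -> : a = a * (1 - h mu * (z - mu%:MP)) + h mu * (a * (z - mu%:MP)).
    by ring.
  by apply: ID; apply: IM.
have noroot (p : {poly K}) : I (ev p) -> p = 0.
  move=> hp; apply: contra_notP I1 => /eqP p0.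
  have [r rE] := closed_field_poly_normal p.
  have {hp} : I (1 * ev (\prod_(mu <- r) ('X - mu%:P))).
    rewrite mul1r; move: hp; rewrite {1}rE /ev map_polyZ hornerZ => hp.
    move: (IM ((lead_coef p)^-1)%:MP _ hp).
    by rewrite mulrA -mpolyCM mulVf ?lead_coef_eq0 // mul1r.
  elim: r 1 {rE} => [|mu r IH] a.
    by rewrite big_nil /ev rmorph1 hornerC mulr1.
  rewrite big_cons /ev rmorphM hornerM /= rmorphB /= map_polyX map_polyC /=.
  rewrite hornerXsubC mulrA => /IH; exact: invP.
apply: uncountableK.
(* If for every [k] only finitely many inverses had size at most [k], then [K] would be
   countable. *)
have -> : [set: K] = \bigcup_(k in [set: nat]) [set lam | (msize (h lam) <= k)%N].
  by apply/esym/seteqP; split => // lam _; exists (msize (h lam)) => //=.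
apply: bigcup_countable => // k _; apply: finite_set_countable; apply: contrapT.
pose D := #|{: 'X_{1..n < k}}|.
move=> inf; have [B Bk DB] := infinite_set_fset D.+1 inf.
pose lam (i : 'I_D.+1) : K := (enum_fset B)`_i.
have lamB i : lam i \in B by apply: mem_nth; apply: leq_trans DB.
have laminj : injective lam.
  move=> i j /eqP; rewrite /lam nth_uniq ?fset_uniq //; first by move/eqP/val_inj.
    exact: leq_trans DB.
  exact: leq_trans DB.
have hk i : (msize (h (lam i)) <= k)%N by exact: (Bk _ (lamB i)).
pose M : 'M[K]_(D.+1, D) := \matrix_(i, j) (h (lam i))@_(enum_val j : 'X_{1..n < k}).
have [c cM c0] : exists2 c : 'rV[K]_D.+1, c *m M = 0 & c != 0.
  have : kermx M != 0.
    by rewrite kermx_eq0 -row_leq_rank -ltnNge ltnS rank_leq_col.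
  move/rowV0Pn => [c /sub_kermxP cM c0]; by exists c.
have ch : \sum_i (c 0 i)%:MP * h (lam i) = 0.
  transitivity (\sum_i c 0 i *: \sum_(m : 'X_{1..n < k}) (h (lam i))@_m *: 'X_[K, m]).
    by apply: eq_bigr => i _; rewrite mul_mpolyC {1}(mpolywE (hk i)).
  under eq_bigr do rewrite scaler_sumr.
  rewrite exchange_big big1 //= => m _.
  under eq_bigr do rewrite scalerA.
  rewrite -scaler_suml; move/rowP/(_ (enum_rank m)): cM; rewrite !mxE => cM.
  rewrite [X in X *: _](_ : _ = 0) ?scale0r // -[RHS]cM.
  by apply: eq_bigr => i _; rewrite mxE enum_rankK.
(* The polynomial obtained from [sum_i c_i / (z - lam_i) = 0] by clearing denominators. At a point
   [lam_i] with [c_i != 0] only the [i]-th summand survives, so [q] is nonzero. *)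
pose q : {poly K} := \sum_i c 0 i *: \prod_(l | l != i) ('X - (lam l)%:P).
have evX (P : pred 'I_D.+1) :
    ev (\prod_(l | P l) ('X - (lam l)%:P)) = \prod_(l | P l) (z - (lam l)%:MP).
  rewrite /ev rmorph_prod horner_prod /=; apply: eq_bigr => l _.
  by rewrite rmorphB /= map_polyX map_polyC /= hornerXsubC.
have q0 : q = 0.
  apply: noroot; rewrite /q /ev rmorph_sum horner_sum /=.
  pose P := \prod_l (z - (lam l)%:MP).
  have hc : \sum_i P * ((c 0 i)%:MP * h (lam i)) = 0 by rewrite -mulr_sumr ch mulr0.
  rewrite -[X in I X]subr0 -[X in I (_ - X)]hc -sumrB.
  apply: ideal_sum => // i _.
  rewrite map_polyZ hornerZ [(map_poly _ _).[z]]evX /P [X in _ - X * _](bigD1 i) //=.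
  set Q := \prod_(l | _) _.
  have -> : forall b d H : S, b * Q - d * Q * (b * H) = b * Q * (1 - H * d).
    by move=> b d H; ring.
  by apply: IM.
have [i ci] : exists i, c 0 i != 0.
  by apply/existsP; apply: contra_neqT c0 => /existsPn c0; apply/rowP => i;
     rewrite mxE; apply/eqP; rewrite -[_ == _]negbK c0.
move/(congr1 (horner^~ (lam i))): q0; rewrite horner0 /q horner_sum (bigD1 i) //=.
rewrite [X in _ + X]big1 ?addr0 => [|j ji]; last first.
  rewrite hornerZ horner_prod (bigD1 i) 1?eq_sym //= hornerXsubC subrr.
  by rewrite mul0r mulr0.
rewrite hornerZ horner_prod => /eqP; rewrite mulf_eq0 (negPf ci) /=.
move/prodf_eq0 => [l li]; rewrite hornerXsubC subr_eq0 => /eqP/laminj e.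
by rewrite e eqxx in li.
Qed.

End Nullstellensatz.

(** Adjoining suitable [X_j - v_j] one variable at a time keeps the ideal proper. In the resulting
    ideal [J] every [p] is congruent to the constant [p(v)]; for [p] in [I] this constant lies in
    [J], so it is zero. *)
Lemma nullstellensatz (K : closedFieldType) (n : nat) (I : {mpoly K[n]} -> Prop) :
  ~ countable [set: K] -> ideal_pred I -> ~ I 1 ->
  exists v : 'I_n -> K, forall p, I p -> p.@[v] = 0.
Proof.
move=> unc idI I1.
have [J [idJ J1 IJ XJ]] : exists J, [/\ ideal_pred J, ~ J 1,
    forall p, I p -> J p & forall j, j \in enum 'I_n -> exists lam, J ('X_j - lam%:MP)].
  elim: (enum 'I_n) => [|j r [J [idJ J1 IJ XJ]]]; first by exists I.
  have [lam hlam] := ideal_adjoin_proper unc idJ J1 'X_j.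
  exists (ideal_adjoin J ('X_j - lam%:MP)); split => //.
  - exact: ideal_adjoinP.
  - by move=> p /IJ; exact: sub_ideal_adjoin.
  move=> i; rewrite inE => /orP[/eqP->|/XJ[mu hmu]].
    by exists lam; exact: mem_ideal_adjoin.
  by exists mu; exact: sub_ideal_adjoin.
have /choice[v vP] j := XJ j (mem_enum _ j).
exists v => p Ip; case: (idJ) => J0 JD JM.
have : J (p - p.@[v]%:MP).
  have JMul q r : J (q - q.@[v]%:MP) -> J (r - r.@[v]%:MP) -> J (q * r - (q * r).@[v]%:MP).
    move=> hq hr; rewrite mevalM mpolyCM.
    have -> : q * r - q.@[v]%:MP * r.@[v]%:MP =
       r * (q - q.@[v]%:MP) + q.@[v]%:MP * (r - r.@[v]%:MP) by ring.
    by apply: JD; apply: JM.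
  have JX (m : 'X_{1..n}) : J ('X_[m] - 'X_[m].@[v]%:MP).
    rewrite mpolyXE_id; elim/big_ind: _ => [||i _].
    - by rewrite meval1 mpolyC1 subrr.
    - exact: JMul.
    elim: (m i) => [|k IH]; first by rewrite expr0 meval1 mpolyC1 subrr.
    by rewrite exprS; apply: JMul => //; rewrite mevalXU.
  elim/mpolyind: p {Ip} => [|c m p _ _ IH]; first by rewrite meval0 mpolyC0 subrr.
  rewrite mevalD mevalZ mpolyCD mpolyCM -mul_mpolyC.
  have -> : forall a X Y P q : {mpoly K[n]}, a * X + P - (a * Y + q) = a * (X - Y) + (P - q).
    by move=> *; ring.
  by apply: JD => //; apply: JM.
move/(idealB idJ (IJ _ Ip)); rewrite opprB addrC subrK => Jv.
apply: contra_notP J1 => /eqP pv.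
by have := JM (p.@[v]^-1)%:MP _ Jv; rewrite -mpolyCM mulVf // mpolyC1.
Qed.

(** * The Jacobian ideal of a smooth form *)

Lemma mcoeff_mulX (R : nzRingType) n (p : {mpoly R[n]}) i (m : 'X_{1..n}) :
  (p * 'X_i)@_m = if m i == 0%N then 0 else p@_(m - U_(i)).
Proof.
case: ifPn => [mi|]; last first.
  by rewrite -lep1mP => /submK e; rewrite -{1}e addmC mcoeffMX.
apply: contraTeq mi; rewrite -mcoeff_msupp (perm_mem (msuppMX _ _)).
by move=> /mapP[m' _ ->]; rewrite mnmDE mnm1E eqxx.
Qed.

(** * Homogeneous components and Euler's identity *)

Section Homogeneous.
Variables (K : fieldType) (n : nat).
Implicit Types (p q : {mpoly K[n]}) (i j : 'I_n) (m : 'X_{1..n}).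

Lemma dhomog_mdeg d p m : p \is d.-homog -> m \in msupp p -> mdeg m = d.
Proof. by move=> hp /(dhomog_mf hp). Qed.

Lemma pihomogM d e p q : q \is e.-homog ->
  pihomog mdeg (d + e) (p * q) = pihomog mdeg d p * q.
Proof.
move=> hq; elim/mpolyind: p => [|c m p _ _ IH]; first by rewrite mul0r !linear0 mul0r.
rewrite mulrDl !linearD /= mulrDl {}IH; congr (_ + _).
rewrite -scalerAl !linearZ /= -scalerAl pihomogX; congr (_ *: _).
have hm : 'X_[m] * q \is (mdeg m + e).-homog by rewrite dhomogM ?dhomogX.
case: eqP => [<-|/eqP ne]; first by rewrite pihomog_dE.
by rewrite mul0r; apply: pihomog_ne0 hm; rewrite eqn_add2r.
Qed.

Lemma pihomogM_lt d e p q : q \is e.-homog -> (d < e)%N -> pihomog mdeg d (p * q) = 0.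
Proof.
move=> hq de; elim/mpolyind: p => [|c m p _ _ IH]; first by rewrite mul0r linear0.
rewrite mulrDl linearD /= IH addr0 -scalerAl linearZ /=.
have hm : 'X_[m] * q \is (mdeg m + e).-homog by rewrite dhomogM ?dhomogX.
rewrite (pihomog_ne0 _ hm) ?scaler0 //; apply: contraTneq de => <-.
by rewrite -leqNgt leq_addl.
Qed.

Lemma pihomog_gt d p : (msize p <= d)%N -> pihomog mdeg d p = 0.
Proof.
move=> pd; rewrite pihomogE big_seq_cond big1 // => m /andP[/msize_mdeg_lt mp /eqP e].
by move: (leq_trans mp pd); rewrite e ltnn.
Qed.

Lemma dhomog_mderiv d p i : p \is d.+1.-homog -> p^`M(i) \is d.-homog.
Proof.
move=> hp; apply/dhomogP => m; rewrite mcoeff_msupp mcoeff_mderiv => pm.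
have : p@_(m + U_(i)) != 0 by apply: contraNneq pm => ->; rewrite mul0rn.
rewrite -mcoeff_msupp => /(dhomog_mdeg hp).
by rewrite mdegD mdeg1 addn1 => -[].
Qed.

Lemma mderiv_euler d p : p \is d.-homog -> \sum_i p^`M(i) * 'X_i = d%:R *: p.
Proof.
move=> hp; apply/mpolyP => m; rewrite mcoeffZ raddf_sum /=.
transitivity (\sum_i (m i)%:R * p@_m).
  apply: eq_bigr => i _; rewrite mcoeff_mulX; case: eqP => [->|/eqP mi].
    by rewrite mul0r.
  by rewrite mcoeff_mderiv submK ?lep1mP // mnmBE mnm1E eqxx subn1 prednK ?lt0n // mulr_natl.
rewrite -mulr_suml -natr_sum -mdegE; have [pm|pm] := eqVneq p@_m 0.
  by rewrite pm !mulr0.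
by have /(_ m) -> := dhomog_mdeg hp; rewrite ?mcoeff_msupp.
Qed.

End Homogeneous.

Section JacobianIdeal.
Variables (K : closedFieldType) (n d : nat).
Hypothesis charK : [pchar K] =i pred0.
Hypothesis uncountableK : ~ countable [set: K].
Hypothesis socle_det : socle_in_det K n.
Variable f : {mpoly K[n]}.
Hypothesis homf : f \is d.+2.-homog.
Hypothesis smoothf : forall z : 'I_n -> K,
  (forall j, (f^`M(j)).@[z] = 0) -> forall i, z i = 0.

Local Notation J := (in_ideal (fun i => f^`M(i))).
Local Notation H := (\det (\matrix_(i < n, j < n) f^`M(i)^`M(j))).

Lemma in_idealP (S : comNzRingType) k (g : 'I_k -> S) : ideal_pred (in_ideal g).
Proof.
split.
- by exists (fun=> 0); rewrite big1 // => i _; rewrite mul0r.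
- move=> _ _ [a ->] [b ->]; exists (fun i => a i + b i).
  by rewrite -big_split; apply: eq_bigr => i _; rewrite mulrDl.
move=> c _ [a ->]; exists (fun i => c * a i).
by rewrite mulr_sumr; apply: eq_bigr => i _; rewrite mulrA.
Qed.

Lemma in_ideal_gen (S : comNzRingType) k (g : 'I_k -> S) i : in_ideal g (g i).
Proof.
exists (fun j => (j == i)%:R); rewrite (bigD1 i) //= eqxx mul1r big1 ?addr0 //.
by move=> j /negPf ->; rewrite mul0r.
Qed.

Let J0 : J 0.
Proof. by case: (in_idealP (fun i => f^`M(i))). Qed.
Let JD p q : J p -> J q -> J (p + q).
Proof. by case: (in_idealP (fun i => f^`M(i))) => _ + _; apply. Qed.
Let JM p q : J q -> J (p * q).
Proof. by case: (in_idealP (fun i => f^`M(i))) => _ _; apply. Qed.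
Let JZ c p : J p -> J (c *: p). Proof. by rewrite -mul_mpolyC; exact: JM. Qed.

Lemma homog_partial i : f^`M(i) \is d.+1.-homog.
Proof. exact: dhomog_mderiv homf. Qed.

Lemma jacobian_pihomog k p : J p -> J (pihomog mdeg k p).
Proof.
move=> [a ->]; rewrite linear_sum /=; apply: (ideal_sum (in_idealP _)) => i _.
have [dk|kd] := leqP d.+1 k; last first.
  by rewrite (pihomogM_lt _ (homog_partial i)) //; exact: J0.
by rewrite -(subnK dk) (pihomogM _ _ (homog_partial i)); apply/JM/in_ideal_gen.
Qed.

Lemma jacobian_neq1 : ~ J 1.
Proof.
move/(jacobian_pihomog 0) => [a]; rewrite pihomog_dE ?dhomog1 // => e.
have : meval (fun=> 0) (1 : {mpoly K[n]}) = 0.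
  rewrite e raddf_sum big1 // => i _ /=; rewrite mevalM.
  suff -> : (f^`M(i)).@[fun=> 0] = 0 by rewrite mulr0.
  rewrite mevalE big_seq big1 // => m /(dhomog_mdeg (homog_partial i)) dm.
  have [j mj] : exists j, m j != 0%N.
    apply/existsP; apply: contra_eqT dm => /existsPn m0.
    rewrite mdegE big1 // => j _; have := m0 j; by rewrite negbK => /eqP.
  by rewrite (bigD1 j) //= expr0n (negPf mj) mul0r mulr0.
by rewrite meval1 => /eqP; rewrite oner_eq0.
Qed.

(* By the Nullstellensatz 1 lies in J + (X_j - 1); comparing homogeneous
   components turns a representation of 1 into one of a power of X_j. *)
Lemma jacobian_powX j : exists k, J ('X_j ^+ k).
Proof.
have : ideal_adjoin J ('X_j - 1) 1.
  apply: contrapT => /(nullstellensatz uncountableK (ideal_adjoinP (in_idealP _) _)).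
  case=> v hv; have vj : v j = 1.
    apply/eqP; rewrite -subr_eq0; apply/eqP.
    have := hv _ (mem_ideal_adjoin (in_idealP _) ('X_j - 1)).
    by rewrite mevalB mevalXU meval1.
  have /smoothf/(_ j)/eqP : forall i, (f^`M(i)).@[v] = 0.
    by move=> i; apply/hv/sub_ideal_adjoin/in_ideal_gen.
  by rewrite vj oner_eq0.
move=> [a [u [hu e]]].
(* With [1 = u + a (X_j - 1)], the component of [u] in degree [k + 1] is [a_(k+1) - ...] shifted by
   the previous one, namely [a_(k+1) - a_k X_j + X_j * 0]; with the constant term of [u] as start,
   [X_j ^ k] is congruent to [- a_k], which vanishes for large [k]. *)
have eX k : J ('X_j ^+ k + pihomog mdeg k a).
  have hX : ('X_j : {mpoly K[n]}) \is 1.-homog by rewrite dhomogX /= mdeg1.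
  elim: k => [|k IH].
    have := jacobian_pihomog 0 hu; rewrite -(canLR (addrK _) e) mulrBr mulr1.
    rewrite !raddfB /= (pihomogM_lt _ hX) // pihomog_dE ?dhomog1 //.
    by rewrite oppr0 add0r opprK.
  have := jacobian_pihomog k.+1 hu; rewrite -(canLR (addrK _) e) mulrBr mulr1.
  rewrite !raddfB /= -addn1 (pihomogM _ _ hX) (pihomog_ne0 _ (dhomog1 _ _)) ?addn1 //.
  by move=> h; have := JD h (JM 'X_j IH); congr J; rewrite exprS; ring.
by exists (msize a); have := eX (msize a); rewrite pihomog_gt // addr0.
Qed.

Lemma jacobian_powX_uniform : exists k, forall j, J ('X_j ^+ k).
Proof.
have /choice[k hk] := jacobian_powX.
exists (\max_j k j)%N => j; rewrite -(subnK (leq_bigmax j)) exprD.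
exact: JM.
Qed.

(** Cramer's rule: by Euler's identity the Hessian matrix sends the vector of variables to [d.+1]
    times the gradient, and the adjugate is applied to this equation. *)
Lemma hessian_mulX j : J (H * 'X_j).
Proof.
set A := \matrix_(_, _) _.
have AX i : \sum_l A i l * 'X_l = d.+1%:R *: f^`M(i).
  rewrite -(mderiv_euler (homog_partial i)).
  by apply: eq_bigr => l _; rewrite mxE.
have -> : \det A * 'X_j = \sum_i (d.+1%:R *: \adj A j i) * f^`M(i).
  under eq_bigr do rewrite -scalerAl scalerAr -AX mulr_sumr.
  rewrite exchange_big /= (bigD1 j) //= [X in _ + X]big1 => [|l lj].
    rewrite addr0; under eq_bigr do rewrite mulrA.
    by rewrite -mulr_suml; have /matrixP/(_ j j) := mul_adj_mx A; rewrite !mxE eqxx => ->.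
  under eq_bigr do rewrite mulrA.
  rewrite -mulr_suml; have /matrixP/(_ j l) := mul_adj_mx A; rewrite !mxE => ->.
  by rewrite eq_sym (negPf lj) mul0r.
by eexists.
Qed.

Lemma hessian_homog : H \is (n * d).-homog.
Proof.
rewrite /determinant; apply: rpred_sum => s _.
suff h : \prod_i (\matrix_(i < n, j < n) f^`M(i)^`M(j)) i (s i) \is (n * d).-homog.
  by rewrite mulr_sign; case: ifP => _; rewrite ?rpredN.
have -> : (n * d)%N = (\sum_(i < n) d)%N by rewrite sum_nat_const card_ord.
elim/big_ind2: _ => [|p k q l|i _]; [exact: dhomog1|exact: dhomogM|].
by rewrite mxE; apply/dhomog_mderiv/dhomog_mderiv.
Qed.

(** Euler's identity allows [A] to be the Hessian matrix divided by [d.+1]. The polynomial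
    multiplier [s] may be replaced by its constant term, because every variable multiplies the
    Hessian into [J]. *)
Lemma jacobian_socle g : (forall j, J (g * 'X_j)) -> exists c : K, J (g - c *: H).
Proof.
move=> gX; have [k hk] := jacobian_powX_uniform.
have d0 : d.+1%:R != 0 :> K.
  by apply/negP => /(natf0_pchar (ltn0Sn d))[p]; rewrite charK.
pose A : 'M[{mpoly K[n]}]_n := \matrix_(i, j) (d.+1%:R^-1 *: f^`M(i)^`M(j)).
have fA i : f^`M(i) = \sum_j A i j * 'X_j.
  under eq_bigr do rewrite mxE -scalerAl.
  by rewrite -scaler_sumr (mderiv_euler (homog_partial i)) scalerA mulVf // scale1r.
have [s hs] := socle_det fA hk gX.
have AH : \det A = (d.+1%:R^-1 ^+ n) *: H.
  rewrite -mul_mpolyC rmorphXn -detZ; congr (\det _); apply/matrixP => i j.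
  by rewrite !mxE mul_mpolyC.
have sH q : J (q * H - q@_0%MM *: H).
  elim/mpolyind: q => [|c m p _ _ IH]; first by rewrite mcoeff0 mul0r scale0r subrr.
  rewrite mcoeffD mcoeffZ mcoeffX mulrDl scalerDl opprD addrACA.
  apply: JD => //; have [->|m0] := eqVneq m 0%MM.
    by rewrite mpolyX0 mulr1 -scalerAl mul1r subrr.
  rewrite mulr0 scale0r subr0 -scalerAl; apply: JZ.
  have [j mj] : exists j, m j != 0%N.
    apply/existsP; apply: contra_neqT m0 => /existsPn m0; apply/mnmP => j.
    by have := m0 j; rewrite negbK mnm0E => /eqP.
  have /submK <- : (U_(j) <= m)%MM by rewrite lep1mP.
  by rewrite mpolyXD -mulrA [_ * H]mulrC; apply/JM/hessian_mulX.
exists (s@_0%MM * d.+1%:R^-1 ^+ n).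
have := JD hs (JZ (d.+1%:R^-1 ^+ n) (sH s)); congr J.
by rewrite AH scalerBr -scalerAr scalerA addrA subrK mulrC.
Qed.

Let homogJ M := forall p : {mpoly K[n]}, p \is M.-homog -> J p.

(** Pigeonhole: a monomial of degree [n * k + 1] is divisible by some [X_j ^ k]. *)
Let exists_homogJ : exists M, homogJ M.
Proof.
have [k hk] := jacobian_powX_uniform; exists (n * k).+1 => p hp.
rewrite [p]mpolyE big_seq; apply: (ideal_sum (in_idealP _)) => m hm; apply: JZ.
have [j mj] : exists j, (k <= m j)%N.
  apply/existsP; apply: contra_eqT (dhomog_mdeg hp hm) => /existsPn mk.
  have : (mdeg m <= \sum_(j < n) k)%N.
    by rewrite mdegE leq_sum // => j _; apply: ltnW; rewrite ltnNge mk.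
  by rewrite sum_nat_const card_ord -ltnS ltn_neqAle => /andP[].
have -> : 'X_[m] = 'X_[m - U_(j) *+ k] * 'X_j ^+ k :> {mpoly K[n]}.
  rewrite mpolyXn -mpolyXD submK //; apply/mnm_lepP => i.
  by rewrite mulmnE mnm1E; case: eqP => [<-|]; rewrite ?mul1n.
exact: JM.
Qed.

(** Let [M.+1] be the least degree all of whose forms lie in [J]. A form [p] of degree [M] outside
    [J] is a socle element, so it is congruent to a multiple of the Hessian; comparing degrees gives
    [M = n * d], and the Hessian cannot lie in [J]. *)
Lemma hessian_notin_jacobian : ~ J H /\
  forall p : {mpoly K[n]}, p \is (n * d).+1.-homog -> J p.
Proof.
have exM : exists M, `[< homogJ M >] by have [M hM] := exists_homogJ; exists M; apply/asboolP.
case: (ex_minnP exM) => -[|M] /asboolP hM minM.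
  by case: jacobian_neq1; apply: hM; exact: dhomog1.
have [p hp pJ] : exists2 p : {mpoly K[n]}, p \is M.-homog & ~ J p.
  apply: contrapT => h; have /minM : `[< homogJ M >].
    by apply/asboolP => p hp; apply: contrapT => pJ; apply: h; exists p.
  by rewrite ltnn.
have [j|c pc] := @jacobian_socle p.
  by apply: hM; rewrite -addn1 dhomogM // dhomogX /= mdeg1.
have MN : M = (n * d)%N.
  apply: contra_notP pJ => /eqP MN; have := jacobian_pihomog M pc.
  rewrite raddfB /= linearZ /= pihomog_dE // (pihomog_ne0 _ hessian_homog).
    by rewrite scaler0 subr0.
  by rewrite eq_sym.
rewrite -MN; split=> // HJ; apply: pJ.
by rewrite -(subrK (c *: H) p); apply: JD => //; apply: JZ.
Qed.

Lemma jacobian_top_socle p j : p \is (n * d).-homog -> J (p * 'X_j).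
Proof.
move=> hp; apply: (hessian_notin_jacobian.2).
by rewrite -addn1 dhomogM // dhomogX /= mdeg1.
Qed.

End JacobianIdeal.

(** * The algebra M_f and the associated form *)

Section PowerOfLinearForm.
Variables (A : comNzRingType) (n : nat) (a : 'I_n -> A).

(** The multinomial theorem with denominators cleared, as [A] is an arbitrary commutative ring. The
    induction splits off one linear factor. *)
Lemma mcoeff_linear_exp N (m : 'X_{1..n}) : mdeg m = N ->
  ((\sum_j (a j)%:MP * 'X_j) ^+ N)@_m *+ (\prod_i (m i)`!)%N
    = (\prod_i a i ^+ m i) *+ N`!.
Proof.
elim: N m => [|N IH] m.
  move/eqP; rewrite mdeg_eq0 => /eqP->; rewrite expr0 mcoeff1 eqxx fact0.
  by rewrite !big1 // => i _; rewrite mnm0E ?expr0.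
move=> mN; rewrite exprS mulr_suml raddf_sum /= -sumrMnl.
transitivity (\sum_i ((\prod_i a i ^+ m i) *+ N`!) *+ m i); last first.
  by rewrite sumrMnr -mdegE mN -mulrnA mulnC -factS.
apply: eq_bigr => i _; rewrite [_ * 'X_i]mulrC -mulrA mulrC -mulrA mcoeffCM.
rewrite mcoeff_mulX; case: eqP => [->|/eqP mi]; first by rewrite mulr0 mul0rn mulr0n.
have [k mk] : exists k, m i = k.+1 by exists (m i).-1; rewrite prednK // lt0n.
have mE j : (m - U_(i))%MM j = (m j - (i == j))%N by rewrite mnmBE mnm1E.
have mNi j : j != i -> (m - U_(i))%MM j = m j.
  by move=> ji; rewrite mE eq_sym (negPf ji) subn0.
have mEi : (m - U_(i))%MM i = k by rewrite mE eqxx mk subn1.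
have -> : (\prod_j (m j)`! = k.+1 * \prod_j ((m - U_(i))%MM j)`!)%N.
  rewrite (bigD1 i) //= [in RHS](bigD1 i) //= mEi mk factS mulnA; congr (_ * _)%N.
  by apply: eq_bigr => j ji; rewrite mNi.
rewrite mulnC mulrnA -mulrnAr IH; last first.
  have : (U_(i) <= m)%MM by rewrite lep1mP.
  by move/submK => e; move: mN; rewrite -{1}e mdegD mdeg1 addn1 => -[].
rewrite mk mulrnAr; congr (_ *+ _ *+ _).
rewrite (bigD1 i) //= [in RHS](bigD1 i) //= mEi mk exprS mulrA; congr (_ * _).
by apply: eq_bigr => j ji; rewrite mNi.
Qed.

End PowerOfLinearForm.

Section Milnor.
Variables (K : closedFieldType) (n' d' : nat).
Local Notation n := n'.+1.
Local Notation d := d'.+2.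
Local Notation N := (n * (d - 2))%N.
Hypothesis charK : [pchar K] =i pred0.
Hypothesis uncountableK : ~ countable [set: K].
Hypothesis socle_det : socle_in_det K n.
Variable f : dhomog n K d.
Hypothesis smoothf : smooth_form f.

Local Notation J := (in_ideal (fun i => (mpoly_of_dhomog f)^`M(i))).
Local Notation H := (hessian f).

Let homf : mpoly_of_dhomog f \is d.-homog. Proof. exact: dhomog_is_dhomog. Qed.
Let eN : N = (n * d')%N. Proof. by rewrite subn2. Qed.
Let idJ : ideal_pred J. Proof. exact: in_idealP. Qed.

Lemma clsP p q : cls f p = cls f q <-> J (p - q).
Proof.
have -> : J (p - q) <-> p - q \in jac_ideal f.
  by rewrite unfold_in; split=> [h|/asboolP //]; apply/asboolP.
by rewrite (Quotient.idealrBE (jac_ideal f)); split=> [/eqP|e]; last exact/eqP.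
Qed.
Lemma clsD p q : cls f (p + q) = cls f p + cls f q.
Proof. by rewrite /cls rmorphD. Qed.
Lemma clsM p q : cls f (p * q) = cls f p * cls f q.
Proof. by rewrite /cls rmorphM. Qed.
Lemma cls0 : cls f 0 = 0.
Proof. by rewrite /cls rmorph0. Qed.
Lemma cls_surj x : exists p, x = cls f p.
Proof. by exists (repr x); rewrite /cls reprK. Qed.

Lemma cls_eq0 p : cls f p = 0 <-> J p.
Proof. by rewrite -cls0 clsP subr0. Qed.

Lemma socleP p : socle (cls f p) <-> forall j, J (p * 'X_j).
Proof.
split=> h j; have := h j; first by rewrite -clsM cls_eq0 mulrC.
by rewrite mulrC -cls_eq0 clsM.
Qed.

Lemma socle_hessian_mul x : socle x -> exists c, x = cls f (c *: H).
Proof.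
have [p ->] := cls_surj x => /socleP hp.
have [c hc] := jacobian_socle charK uncountableK socle_det homf smoothf hp.
by exists c; apply/clsP.
Qed.

Lemma socle_hessian c : socle (cls f (c *: H)).
Proof.
apply/socleP => j; rewrite -scalerAl -mul_mpolyC; case: idJ => _ _; apply.
exact: hessian_mulX homf j.
Qed.

Lemma cls_hessian_inj : injective (fun c => cls f (c *: H)).
Proof.
move=> a b /clsP; rewrite -scalerBl => hJ; apply: contrapT => /eqP ab.
have [HJ _] := hessian_notin_jacobian charK uncountableK socle_det homf smoothf.
apply: HJ; rewrite -[X in J X]scale1r -(mulVf (x := a - b)) ?subr_eq0 // -scalerA.
by rewrite -mul_mpolyC; case: idJ => _ _; apply.
Qed.

(** The socle is the line through the class of the Hessian, and [w] reads off the coefficient on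
    that line. *)
Lemma exists_omega : exists w : milnor f -> K, is_omega w.
Proof.
have /choice[w wP] : forall x : milnor f, exists c, socle x -> x = cls f (c *: H).
  move=> x; have [/socle_hessian_mul[c ->]|] := EM (socle x); first by exists c.
  by exists 0.
have wE c : w (cls f (c *: H)) = c.
  by apply: cls_hessian_inj; rewrite /= -wP //; exact: socle_hessian.
exists w; split.
- move=> c x y /socle_hessian_mul[a ->] /socle_hessian_mul[b ->].
  rewrite -clsM -clsD mul_mpolyC scalerA -scalerDl !wE; done.
- by move=> x /socle_hessian_mul[c ->]; rewrite wE => ->; rewrite scale0r cls0.
- by move=> c; exists (cls f (c *: H)); [exact: socle_hessian|rewrite wE].
by rewrite -[hessian f]scale1r wE.
Qed.

Lemma omegaP : is_omega (@omega K n' d' f).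
Proof. by have [w hw] := exists_omega; rewrite /omega; apply: (xgetPex _ (ex_intro _ w hw)). Qed.

Lemma cls_top_socle p : p \is N.-homog -> socle (cls f p).
Proof.
rewrite eN => hp; apply/socleP => j.
exact: (jacobian_top_socle charK uncountableK socle_det homf smoothf j hp).
Qed.

(** [omega] is only known to be linear on the socle; forms of degree [N] have their classes
    there. *)
Lemma omega_lin c p q : p \is N.-homog -> q \is N.-homog ->
  omega (cls f (c *: p + q)) = c * omega (cls f p) + omega (cls f q).
Proof.
move=> hp hq; case: omegaP => wD _ _ _.
rewrite -wD; [|exact: cls_top_socle|exact: cls_top_socle].
by rewrite -clsM -clsD mul_mpolyC.
Qed.

Lemma omega0 : omega (0 : milnor f) = 0.
Proof.
have h0 : (0 : {mpoly K[n]}) \is N.-homog by exact: rpred0.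
have := omega_lin 1 h0 h0; rewrite scale1r addr0 cls0 mul1r.
by move/eqP; rewrite -subr_eq0 opprD addrA subrr sub0r oppr_eq0 => /eqP.
Qed.

Lemma omega_sum (I : Type) (r : seq I) (F : I -> {mpoly K[n]}) (c : I -> K) :
  (forall i, F i \is N.-homog) ->
  omega (cls f (\sum_(i <- r) c i *: F i)) = \sum_(i <- r) c i * omega (cls f (F i)).
Proof.
move=> hF; elim: r => [|i r IH]; first by rewrite !big_nil cls0 omega0.
rewrite !big_cons omega_lin ?IH //; apply: rpred_sum => j _; exact: rpredZ.
Qed.

Lemma omega_eq0 p : p \is N.-homog -> (omega (cls f p) = 0 <-> J p).
Proof.
move=> hp; rewrite -cls_eq0; case: omegaP => _ wI _ _.
by split=> [/wI|->]; [apply; exact: cls_top_socle|exact: omega0].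
Qed.

Lemma cls_exp_prod (m : 'X_{1..n}) : cls f 'X_[m] = \prod_i cls f 'X_i ^+ m i.
Proof.
rewrite mpolyXE_id /cls rmorph_prod; apply: eq_bigr => i _; exact: rmorphXn.
Qed.

Let fact_neq0 k : k`!%:R != 0 :> K.
Proof. by apply/negP => /(natf0_pchar (fact_gt0 _))[p]; rewrite charK. Qed.

Let prod_fact_neq0 (m : 'X_{1..n}) : (\prod_i (m i)`!)%N%:R != 0 :> K.
Proof. by rewrite natr_prod; apply/prodf_neq0 => i _; exact: fact_neq0. Qed.

Lemma associated_formE (m : 'X_{1..n}) : mdeg m = N ->
  (associated_form f)@_m
    = N`!%:R / (\prod_i (m i)`!)%N%:R * omega (cls f 'X_[m]).
Proof.
move=> mN; set c := _ / _.
have hX : ('X_[m] : {mpoly K[n]}) \is N.-homog by rewrite dhomogX /= mN.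
have h0 : (0 : {mpoly K[n]}) \is N.-homog by exact: rpred0.
transitivity (omega (cls f (c *: 'X_[m]))); last first.
  by rewrite -[c *: _]addr0 omega_lin // cls0 omega0 addr0.
rewrite /associated_form; set F := _ ^+ _.
(* [omega] is not an additive map on all of [M_f], so the coefficients are compared by hand; outside
   the support [omega 0 = 0] is used. *)
have -> : (map_mpoly (@omega K n' d' f) F)@_m = omega F@_m.
  rewrite /map_mpoly /mmap raddf_sum /=.
  have XE (m' : 'X_{1..n}) : mmap1 (fun i => 'X_i : {mpoly K[n]}) m' = 'X_[m'].
    by rewrite mpolyXE_id.
  under eq_bigr do rewrite XE mcoeffCM mcoeffX.
  have [mF|mF] := boolP (m \in msupp F); last first.
    rewrite (memN_msupp_eq0 mF) omega0 big_seq big1 // => m' hm'.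
    by case: eqP mF => [<-|_ _]; [rewrite hm'|rewrite mulr0].
  rewrite (bigD1_seq m) //= eqxx mulr1 big1 ?addr0 // => m' /negPf ->.
  by rewrite mulr0.
congr omega; have fm0 := prod_fact_neq0 m.
have key := mcoeff_linear_exp (fun j => cls f 'X_j) mN.
have clsMn p k : cls f (p *+ k) = cls f p *+ k by rewrite /cls rmorphMn.
have -> : c *: 'X_[m] = ((\prod_i (m i)`!)%N%:R^-1)%:MP * ('X_[m] *+ N`!).
  by rewrite mul_mpolyC -scaler_nat scalerA mulrC.
have clsn k : k%:R = cls f k%:R by rewrite /cls rmorph_nat.
rewrite clsM clsMn cls_exp_prod -key -/F -[F@_m *+ _]mulr_natl mulrA clsn -clsM.
rewrite -mpolyC_nat -mpolyCM mulVf // mpolyC1.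
by rewrite /cls rmorph1 mul1r.
Qed.

(** On a monomial [X^m] the functional gives the coefficient of the associated form times [m! / N!],
    which cancels the multinomial factor of [associated_formE]. *)
Lemma polarE (g : dhomog n K N) :
  polar d' (associated_form f) g = omega (cls f (mpoly_of_dhomog g)).
Proof.
set F := associated_form f.
pose L (p : {mpoly K[n]}) := (\sum_(m <- msupp F) F@_m *: p^`M[m])@_0%MM / (N`!)%:R.
have Llin c p q : L (c *: p + q) = c * L p + L q.
  rewrite /L mulrA -mulrDl -mcoeffZ -mcoeffD scaler_sumr -big_split /=.
  congr (_@_ _ / _); apply: eq_bigr => m _.
  by rewrite linearP scalerDr !scalerA mulrC.
pose LQ (h : dhomog n K N) : K^o := L (mpoly_of_dhomog h).
have LQlin : linear LQ by move=> c h k; exact: Llin.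
pose LQp : {linear dhomog n K N -> K^o} :=
  HB.pack LQ (GRing.isLinear.Build _ _ _ _ LQ LQlin).
have -> : polar d' F g = LQp g by rewrite -[RHS](lfunE LQp).
have LX (m : 'X_{1..n}) : mdeg m = N -> L 'X_[m] = omega (cls f 'X_[m]).
  move=> mN; rewrite /L raddf_sum /=.
  transitivity (F@_m * (\prod_i (m i)`!)%N%:R / N`!%:R).
    congr (_ / _); under eq_bigr => m' _ do
      rewrite mcoeffZ mcoeff_mderivm mcoeffX addm0.
    have [mF|mF] := boolP (m \in msupp F); last first.
      rewrite (memN_msupp_eq0 mF) mul0r big_seq big1 // => m' hm'.
      by case: eqP mF => [->|_ _]; [rewrite hm'|rewrite mul0rn mulr0].
    rewrite (bigD1_seq m) //= eqxx [X in _ + X]big1 ?addr0 => [|m' /negPf mm'].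
      by congr (_ * (_ *+ _)); apply: eq_bigr => i _; rewrite ffactnn.
    by rewrite eq_sym mm' mul0rn mulr0.
  rewrite associated_formE //.
  by have := fact_neq0 N; have := prod_fact_neq0 m; move=> *; field; apply/andP.
have hg := dhomog_is_dhomog g; rewrite /= in hg.
have Xhom m : m \in msupp (mpoly_of_dhomog g) -> mdeg m = N.
  exact: dhomog_mdeg hg.
change (L g = omega (cls f g)).
(* The conditional makes every summand a form of degree [N], as [omega_sum] asks this for all
   indices. *)
have gE : mpoly_of_dhomog g = \sum_(m <- msupp g) g@_m *: 
    (if mdeg m == N then 'X_[m] else 0).
  rewrite {1}[mpoly_of_dhomog g]mpolyE !big_seq; apply: eq_bigr => m /Xhom ->.
  by rewrite eqxx.
have L0 : L 0 = 0.
  by have := Llin 1 0 0; rewrite scale1r addr0 mul1r => /eqP; 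
     rewrite -subr_eq0 opprD addrA subrr sub0r oppr_eq0 => /eqP.
rewrite gE omega_sum => [|m]; last first.
  by case: eqP => [mN|_]; [rewrite dhomogX /= mN|exact: rpred0].
rewrite -/(L _); elim: (msupp g) => [|m r IH]; first by rewrite !big_nil.
rewrite !big_cons Llin IH; congr (_ * _ + _).
by case: eqP => [/LX|_]; [|rewrite L0 cls0 omega0].
Qed.

End Milnor.

(** * Polynomial maps *)

Lemma mderivXU (R : nzRingType) n (i j : 'I_n) :
  ('X_i : {mpoly R[n]})^`M(j) = (i == j)%:R.
Proof.
rewrite mderivX mnm1E; case: eqP => [->|_]; last by rewrite scale0r.
have -> : (U_(j) - U_(j) = 0 :> 'X_{1..n})%MM by rewrite -{1}[U_(j)%MM]add0m addmK.
by rewrite mpolyX0 scale1r.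
Qed.

Section Derivation.
Variables (R T : comNzRingType) (n : nat).
Variables (phi : {rmorphism {mpoly R[n]} -> T}) (D : {mpoly R[n]} -> T).
Hypothesis DD : forall p q, D (p + q) = D p + D q.
Hypothesis DM : forall p q, D (p * q) = D p * phi q + phi p * D q.
Hypothesis DC : forall c, D c%:MP = 0.

(** A derivation along [phi] that kills constants is determined by its values on the variables. The
    chain rules below are instances. *)
Lemma mpoly_derivation p : D p = \sum_i phi p^`M(i) * D 'X_i.
Proof.
pose E p := D p = \sum_i phi p^`M(i) * D 'X_i.
have EM q r : E q -> E r -> E (q * r).
  rewrite /E DM => -> ->; rewrite mulr_suml mulr_sumr -big_split /=.
  by apply: eq_bigr => i _; rewrite mderivM rmorphD !rmorphM /=; ring.
have EC c : E c%:MP.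
  by rewrite /E DC big1 // => i _; rewrite mderivC rmorph0 mul0r.
have EX i : E 'X_i.
  rewrite /E (bigD1 i) //= mderivXU eqxx rmorph1 mul1r big1 ?addr0 // => j ji.
  by rewrite mderivXU eq_sym (negPf ji) rmorph0 mul0r.
have EXn m : E 'X_[m].
  rewrite mpolyXE_id; elim/big_ind: _ => [||i _]; [by rewrite -mpolyC1|exact: EM|].
  by elim: (m i) => [|k IH]; [rewrite expr0 -mpolyC1|rewrite exprS; exact: EM].
elim/mpolyind: p => [|c m p _ _ IH]; first by rewrite -mpolyC0; exact: EC.
have := EM _ _ (EC c) (EXn m); rewrite /E mul_mpolyC DD IH => ->.
by rewrite -big_split; apply: eq_bigr => i _; rewrite mderivD rmorphD mulrDl.
Qed.

End Derivation.

Lemma mderiv_comp_mpoly (R : comNzRingType) n k (p : {mpoly R[n]})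
    (t : n.-tuple {mpoly R[k]}) j :
  (p \mPo t)^`M(j) = \sum_i (p^`M(i) \mPo t) * (tnth t i)^`M(j).
Proof.
have := mpoly_derivation (phi := comp_mpoly t) (D := fun p => (p \mPo t)^`M(j)).
move=> -> => [|q r|q r|c]; last by rewrite comp_mpolyC mderivC.
- by apply: eq_bigr => i _; rewrite comp_mpolyXU -tnth_nth.
- by rewrite raddfD mderivD.
by rewrite rmorphM mderivM.
Qed.

Lemma comp_mpolyA (R : comNzRingType) n k l (p : {mpoly R[n]})
    (t : n.-tuple {mpoly R[k]}) (u : k.-tuple {mpoly R[l]}) :
  (p \mPo t) \mPo u = p \mPo [tuple tnth t i \mPo u | i < n].
Proof.
rewrite [p \mPo t]comp_mpolyEX [p \mPo [tuple _ | _ < _]]comp_mpolyEX.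
rewrite raddf_sum /=; apply: eq_bigr => m _; rewrite comp_mpolyZ; congr (_ *: _).
rewrite !comp_mpolyX rmorph_prod; apply: eq_bigr => i _.
by rewrite rmorphXn tnth_mktuple.
Qed.

Section PolynomialCurve.
Variables (R : comNzRingType) (n : nat) (c : 'I_n -> {poly R}).
Implicit Types p : {mpoly R[n]}.

Lemma horner_mmap p t : (mmap polyC c p).[t] = p.@[fun i => (c i).[t]].
Proof.
rewrite /meval /mmap horner_sum; apply: eq_bigr => m _.
rewrite hornerM hornerC horner_prod; congr (_ * _).
by apply: eq_bigr => i _; rewrite horner_exp.
Qed.

Lemma deriv_mmap p : (mmap polyC c p)^`() = \sum_i mmap polyC c p^`M(i) * (c i)^`().
Proof.
have := mpoly_derivation (phi := mmap polyC c) (D := fun p => (mmap polyC c p)^`()).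
move=> -> => [|q r|q r|a]; last by rewrite mmapC derivC.
- by apply: eq_bigr => i _; rewrite mmapX mmap1U.
- by rewrite raddfD derivD.
by rewrite rmorphM derivM.
Qed.

End PolynomialCurve.

Section AlgebraicDependence.
Variables (K : fieldType) (m D : nat) (F : 'I_D -> {mpoly K[m]}).

Let deg_le s (p : {mpoly K[m]}) := forall u, u \in msupp p -> (mdeg u <= s)%N.

Let deg_leM s t p q : deg_le s p -> deg_le t q -> deg_le (s + t) (p * q).
Proof.
move=> hp hq u /msuppM_le /allpairsP[[u1 u2] [/hp h1 /hq h2 ->]].
by rewrite mdegD leq_add.
Qed.

Let deg_le1 : deg_le 0 1.
Proof. by move=> u; rewrite msupp1 inE => /eqP ->; rewrite mdeg0. Qed.

(* Compare the number k^D of monomials in the F i with exponents < k to the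
   dimension, O(k^m), of the space of polynomials they lie in. *)
Lemma algebraic_dependence : (m < D)%N ->
  exists2 P : {mpoly K[D]}, P != 0 &
    forall v : 'I_m -> K, P.@[fun i => (F i).@[v]] = 0.
Proof.
move=> mD; pose s := (\max_i msize (F i))%N.
(* The products have size at most [L = c * k], and [k > c ^ m] gives [L ^ m = c ^ m * k ^ m < k ^
   m.+1 <= k ^ D]. *)
pose c := (s.+1 * D.+1)%N; pose k := (c ^ m).+1; pose L := (c * k)%N.
pose e2m (e : {ffun 'I_D -> 'I_k}) : 'X_{1..D} := [multinom (e i : nat) | i < D].
pose Fe e := \prod_i F i ^+ e2m e i.
have FeL e : (msize (Fe e) <= L)%N.
  have : deg_le (s * \sum_i e2m e i)%N (Fe e).
    rewrite /Fe big_distrr /=; elim/big_rec2: _ => [|i t p _ IH]; first exact: deg_le1.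
    apply: deg_leM => //; elim: (e2m e i) => [|j IHj]; first by rewrite muln0; exact: deg_le1.
    rewrite exprS mulnS; apply: deg_leM => // u /msize_mdeg_lt/ltnW hu.
    exact: leq_trans hu (leq_bigmax i).
  move=> h; rewrite msizeE; apply/bigmax_leqP_seq => u /h hu _.
  apply: leq_ltn_trans hu _; rewrite /L /c -mulnA.
  have : (\sum_i e2m e i <= D * k)%N.
    rewrite -[X in (_ <= X * _)%N](card_ord D) -sum_nat_const leq_sum // => i _.
    by rewrite mnmE ltnW.
  move=> h'; apply: (@leq_ltn_trans (s * (D * k))%N); first by rewrite leq_mul2l h' orbT.
  apply: (@leq_ltn_trans (s.+1 * (D * k))%N); first by rewrite leq_mul2r leqnSn orbT.
  by rewrite ltn_mul2l ltn_mul2r leqnn.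
pose I := {ffun 'I_D -> 'I_k}; pose Q := 'X_{1..m < L}.
have cardQ : (#|{: Q}| <= L ^ m)%N.
  have -> : (L ^ m = #|{ffun 'I_m -> 'I_L}|)%N by rewrite card_ffun !card_ord.
  have bd (u : Q) i : (u i < L)%N.
    by apply: leq_ltn_trans (bmdeg u); rewrite mdegE (bigD1 i) //= leq_addr.
  pose h (u : Q) := [ffun i => Ordinal (bd u i)].
  apply: (@leq_card _ _ h) => u v /ffunP e; apply/val_inj/mnmP => i.
  by have := e i; rewrite !ffunE => -[].
have cardI : (#|{: Q}| < #|{: I}|)%N.
  rewrite card_ffun !card_ord; apply: leq_ltn_trans cardQ _.
  rewrite /L expnMn; apply: (@leq_trans (k ^ m.+1)%N); last by rewrite leq_pexp2l.
  by rewrite expnS ltn_mul2r expn_gt0 leqnn.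
pose M : 'M[K]_(#|{: I}|, #|{: Q}|) :=
  \matrix_(e, u) (Fe (enum_val e))@_(enum_val u : Q).
have [a aM a0] : exists2 a : 'rV[K]_#|{: I}|, a *m M = 0 & a != 0.
  have : kermx M != 0.
    by rewrite kermx_eq0 -row_leq_rank -ltnNge (leq_ltn_trans (rank_leq_col M)).
  by move/rowV0Pn => [a /sub_kermxP aM a0]; exists a.
have aF : \sum_e a 0 e *: Fe (enum_val e) = 0.
  transitivity (\sum_e a 0 e *: \sum_(u : Q) (Fe (enum_val e))@_u *: 'X_[K, u]).
    by apply: eq_bigr => e _; rewrite {1}(mpolywE (FeL _)).
  under eq_bigr do rewrite scaler_sumr.
  rewrite exchange_big big1 //= => u _.
  under eq_bigr do rewrite scalerA.
  rewrite -scaler_suml; move/rowP/(_ (enum_rank u)): aM; rewrite !mxE => aM.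
  rewrite [X in X *: _](_ : _ = 0) ?scale0r // -[RHS]aM.
  by apply: eq_bigr => e _; rewrite mxE enum_rankK.
exists (\sum_e a 0 e *: 'X_[e2m (enum_val e)]) => [|v].
  apply: contra_neq a0 => e0; apply/rowP => e; rewrite mxE.
  move/(congr1 (mcoeff (e2m (enum_val e)))): e0; rewrite mcoeff0 raddf_sum /=.
  rewrite (bigD1 e) //= mcoeffZ mcoeffX eqxx mulr1 big1 ?addr0 // => e' e'e.
  rewrite mcoeffZ mcoeffX; case: eqP => [/mnmP h|]; last by rewrite mulr0.
  case/eqP: e'e; apply/enum_val_inj/ffunP => i; apply: val_inj.
  by have := h i; rewrite !mnmE.
transitivity (\sum_e a 0 e *: Fe (enum_val e)).@[v]; last by rewrite aF meval0.
rewrite !raddf_sum /=; apply: eq_bigr => e _; rewrite !mevalZ mevalX; congr (_ * _).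
by rewrite /Fe rmorph_prod; apply: eq_bigr => i _; rewrite rmorphXn.
Qed.

End AlgebraicDependence.

(** * The action on forms *)

Lemma exists_root_exp (K : closedFieldType) k (a : K) : (0 < k)%N ->
  exists b, b ^+ k = a.
Proof.
move=> k0; have /closed_rootP[b] : size ('X^k - a%:P) != 1%N.
  by rewrite size_XnsubC // eqSS -lt0n.
by rewrite rootE !hornerE subr_eq0 => /eqP; exists b.
Qed.

(** If [p] were nonzero, [p * q] would have a non-root. This extends identities from a dense open
    set of parameters to all of them. *)
Lemma horner_eq0_poly (K : closedFieldType) (p q : {poly K}) : q != 0 ->
  (forall a, q.[a] != 0 -> p.[a] = 0) -> p = 0.
Proof.
move=> q0 h; apply/eqP/negPn/negP => p0.
have /closed_nonrootP[a] : p * q != 0 by rewrite mulf_neq0.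
rewrite rootE hornerM mulf_eq0 negb_or => /andP[/eqP pa qa].
by case: pa; exact: h.
Qed.

(** * Polynomial functions on a vector space and their pull-backs *)

Section Coordinates.
Variables (K : fieldType) (V : vectType K).
Implicit Types (v w : V) (P : {mpoly K[\dim {:V}]}).

Lemma coordsD v w i : coords (v + w) i = coords v i + coords w i.
Proof. exact: linearD. Qed.
Lemma coordsZ a v i : coords (a *: v) i = a * coords v i.
Proof. exact: linearZ. Qed.
Lemma coords_sum I (r : seq I) (P : pred I) (F : I -> V) i :
  coords (\sum_(j <- r | P j) F j) i = \sum_(j <- r | P j) coords (F j) i.
Proof. exact: linear_sum. Qed.

Lemma coords_expand v : v = \sum_(i < \dim {:V}) coords v i *: (vbasis {:V})`_i.
Proof. exact: (coord_vbasis (memvf v)). Qed.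

Lemma coords_basis (i j : 'I_(\dim {:V})) : coords (vbasis {:V})`_i j = (i == j)%:R.
Proof. exact: (coord_free i j (basis_free (vbasisP fullv))). Qed.

Lemma pol_evalZ k P a v : P \is k.-homog -> pol_eval P (a *: v) = a ^+ k * pol_eval P v.
Proof.
move=> hP; rewrite /pol_eval !mevalE mulr_sumr !big_seq; apply: eq_bigr => m /(dhomog_mdeg hP) <-.
under eq_bigr do rewrite coordsZ exprMn.
rewrite big_split /= mulrCA; congr (_ * (_ * _)).
by rewrite mdegE prodrXr.
Qed.

Lemma pol_eval0 k P : P \is k.+1.-homog -> pol_eval P 0 = 0.
Proof. by move=> hP; rewrite -(scale0r 0) (pol_evalZ _ _ hP) expr0n mul0r. Qed.

Lemma pol_diffD P v w1 w2 : pol_diff P v (w1 + w2) = pol_diff P v w1 + pol_diff P v w2.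
Proof. by rewrite -big_split; apply: eq_bigr => i _; rewrite coordsD mulrDr. Qed.
Lemma pol_diffZ P v a w : pol_diff P v (a *: w) = a * pol_diff P v w.
Proof. by rewrite mulr_sumr; apply: eq_bigr => i _; rewrite coordsZ mulrCA. Qed.

Lemma pol_diff_basis P v (i : 'I_(\dim {:V})) : pol_diff P v (vbasis {:V})`_i = P^`M(i).@[coords v].
Proof.
rewrite /pol_diff (bigD1 i) //= coords_basis eqxx mulr1 big1 ?addr0 // => j ji.
by rewrite coords_basis eq_sym (negPf ji) mulr0.
Qed.

Section PullBack.
Variable l : {linear V -> V}.

Definition pull_back P := P \mPo
  [tuple \sum_(j < \dim {:V}) coords (l (vbasis {:V})`_j) i *: 'X_j | i < \dim {:V}].

Let coords_image v i :
  coords (l v) i = \sum_(j < \dim {:V}) coords v j * coords (l (vbasis {:V})`_j) i.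
Proof.
rewrite {1}[v]coords_expand linear_sum coords_sum; apply: eq_bigr => j _.
by rewrite linearZ coordsZ.
Qed.

Lemma pull_back_eval P v : pol_eval (pull_back P) v = pol_eval P (l v).
Proof.
rewrite /pol_eval comp_mpoly_meval; apply: meval_eq => i.
rewrite tnth_mktuple coords_image raddf_sum /=; apply: eq_bigr => j _.
by rewrite mevalZ mevalXU mulrC.
Qed.

Lemma pull_back_diff P v w : pol_diff (pull_back P) v w = pol_diff P (l v) (l w).
Proof.
have partial (j : 'I_(\dim {:V})) : (pull_back P)^`M(j).@[coords v]
    = \sum_i P^`M(i).@[coords (l v)] * coords (l (vbasis {:V})`_j) i.
  rewrite mderiv_comp_mpoly (raddf_sum (meval _)); apply: eq_bigr => i _ /=.
  rewrite mevalM; congr (_ * _); first exact: (pull_back_eval P^`M(i)).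
  rewrite tnth_mktuple (raddf_sum (mderiv j)) (bigD1 j) //= mderivZ mderivXU eqxx.
  rewrite big1 ?addr0 => [|j' /negPf j'j]; first by rewrite mevalZ meval1 mulr1.
  by rewrite mderivZ mderivXU j'j scaler0.
rewrite /pol_diff; under eq_bigr do rewrite partial mulr_suml.
rewrite exchange_big /=; apply: eq_bigr => i _.
rewrite coords_image mulr_sumr; apply: eq_bigr => j _.
by rewrite -mulrA [_ * coords w j]mulrC.
Qed.

Lemma pull_back_homog k P : P \is k.-homog -> pull_back P \is k.-homog.
Proof.
move=> hP; rewrite /pull_back comp_mpolyEX big_seq; apply: rpred_sum => m /(dhomog_mdeg hP) <-.
apply: rpredZ; rewrite comp_mpolyX mdegE.
elim/big_ind2: _ => [|p e q e' hp hq|i _]; [exact: dhomog1|exact: dhomogM|].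
suff h1 : \sum_(j < \dim {:V}) coords (l (vbasis {:V})`_j) i *: 'X_j
    \is [in K[\dim {:V}], 1.-homog].
  by rewrite tnth_mktuple; have := dhomogMn (m i) h1; rewrite mul1n.
by apply: rpred_sum => j _; apply: rpredZ; rewrite dhomogX /= mdeg1.
Qed.

End PullBack.
End Coordinates.

Section Action.
Variables (K : closedFieldType) (n' d' : nat).
Local Notation n := n'.+1.
Local Notation d := d'.+2.
Local Notation V := (dhomog n K d).
Implicit Types (f g : V) (C D : 'M[K]_n).

Lemma dhomog_inj f g : mpoly_of_dhomog f = mpoly_of_dhomog g -> f = g.
Proof. exact: val_inj. Qed.

Lemma act_linear C : linear (@act K n' d' C).
Proof. by move=> a f g; apply: dhomog_inj; rewrite /= linearP. Qed.
HB.instance Definition _ C := GRing.isLinear.Build K V V _ (@act K n' d' C) (act_linear C).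

Lemma act_mul C D f : C \in unitmx -> D \in unitmx ->
  act C (act D f) = act (C *m D) f.
Proof.
move=> uC uD; apply: dhomog_inj; rewrite /= comp_mpolyA; congr (_ \mPo _).
have invCD : invmx (C *m D) = invmx D *m invmx C.
  have e : (invmx D *m invmx C) *m (C *m D) = 1%:M by rewrite -mulmxA mulKmx ?mulVmx.
  by rewrite -[RHS](@mulmxK _ _ n (C *m D)) ?e ?mul1mx // unitmx_mul uC.
apply: eq_from_tnth => i; rewrite !tnth_mktuple raddf_sum /=.
transitivity (\sum_j \sum_l (invmx D i j * invmx C j l) *: 'X_l : {mpoly K[n]}).
  apply: eq_bigr => j _; rewrite comp_mpolyZ comp_mpolyXU -tnth_nth tnth_mktuple.
  by rewrite scaler_sumr; apply: eq_bigr => l _; rewrite scalerA.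
rewrite exchange_big; apply: eq_bigr => l _ /=.
by rewrite -scaler_suml invCD mxE.
Qed.

Lemma act1 f : act 1%:M f = f.
Proof.
apply: dhomog_inj; rewrite /= -[RHS]comp_mpoly_id; congr (_ \mPo _).
apply: eq_from_tnth => i; rewrite !tnth_mktuple invmx1 (bigD1 i) //= mxE eqxx scale1r.
by rewrite big1 ?addr0 // => j ji; rewrite mxE eq_sym (negPf ji) scale0r.
Qed.

Lemma act_scale a C f : a != 0 -> C \in unitmx ->
  act (a *: C) f = (a^-1) ^+ d *: act C f.
Proof.
move=> a0 uC; apply: dhomog_inj; rewrite /= !comp_mpolyEX scaler_sumr !big_seq.
apply: eq_bigr => m /(dhomog_mdeg (dhomog_is_dhomog f)) md.
rewrite scalerA mulrC -scalerA; congr (_ *: _); rewrite !comp_mpolyX.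
transitivity (\prod_i (a^-1 ^+ m i *: tnth (subst_inv C) i ^+ m i)).
  apply: eq_bigr => i _; rewrite !tnth_mktuple -exprZn; congr (_ ^+ _).
  rewrite scaler_sumr; apply: eq_bigr => j _.
  by rewrite scalerA invmxZ ?mxE // unitmxZ // unitfE.
by rewrite scaler_prod prodrXr -mdegE md.
Qed.

Lemma act_smooth C f : C \in unitmx -> smooth_form f -> smooth_form (act C f).
Proof.
move=> uC sf z hz; pose w i := \sum_j invmx C i j * z j.
have hw : (\row_i ((mpoly_of_dhomog f)^`M(i)).@[w]) *m invmx C = 0.
  apply/rowP => j; rewrite !mxE -[RHS](hz j) /= mderiv_comp_mpoly (raddf_sum (meval _)).
  apply: eq_bigr => i _; rewrite mxE /= mevalM comp_mpoly_meval; congr (_ * _).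
    apply: meval_eq => l; rewrite tnth_mktuple raddf_sum /=.
    by apply: eq_bigr => k _; rewrite mevalZ mevalXU.
  rewrite tnth_mktuple (raddf_sum (mderiv j)) (bigD1 j) //= mderivZ mderivXU eqxx.
  rewrite big1 ?addr0 => [|j' /negPf j'j]; first by rewrite mevalZ meval1 mulr1.
  by rewrite mderivZ mderivXU j'j scaler0.
have /sf w0 : forall i, ((mpoly_of_dhomog f)^`M(i)).@[w] = 0.
  move=> i; have := congr1 (fun A => (A *m C) 0 i) hw.
  by rewrite mulmxKV // mul0mx !mxE.
have z0 : \col_j z j = 0.
  rewrite -[LHS](mulKVmx uC) (_ : invmx C *m _ = 0) ?mulmx0 //.
  apply/colP => i; rewrite !mxE -[RHS](w0 i).
  by apply: eq_bigr => j _; rewrite mxE.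
by move=> i; move/colP/(_ i): z0; rewrite !mxE.
Qed.

End Action.

Section Orbits.
Variables (K : closedFieldType) (n' d' : nat).
Local Notation n := n'.+1.
Local Notation d := d'.+2.
Local Notation V := (dhomog n K d).
Implicit Types (f g : V) (C D : 'M[K]_n).

Lemma SL_orbitP f y :
  SL_orbit <[f]>%VS y <-> exists C : 'M[K]_n, \det C = 1 /\ y = <[act C f]>%VS.
Proof.
have e C : (linfun (act C) @: <[f]> = <[act C f]>)%VS.
  by rewrite limg_line (lfunE (@act K n' d' C)).
by split=> -[C [hC ->]]; exists C; rewrite e.
Qed.

Let unit_det1 C : \det C = 1 -> C \in unitmx.
Proof. by move=> hC; rewrite unitmxE hC unitr1. Qed.

Lemma SL_orbit_eq f y : SL_orbit <[f]>%VS y -> SL_orbit y = SL_orbit <[f]>%VS.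
Proof.
case/SL_orbitP => C [hC ->]; have uC := unit_det1 hC.
apply/seteqP; split=> L /SL_orbitP[D [hD ->]]; apply/SL_orbitP.
  exists (D *m C); rewrite det_mulmx hD hC mulr1 act_mul //; exact: unit_det1.
exists (D *m invmx C); rewrite det_mulmx det_inv hD hC invr1 mulr1; split=> //.
rewrite act_mul ?mulmxKV // unitmx_mul unit_det1 // unitmx_inv.
exact: uC.
Qed.

(** Dividing [C] by an [n]-th root of its determinant gives determinant 1, and scalar matrices do
    not move points of the projective space. *)
Lemma SL_orbit_act f C : C \in unitmx -> SL_orbit <[f]>%VS <[act C f]>%VS.
Proof.
move=> uC; have [b bn] := exists_root_exp (\det C) (ltn0Sn n').
have C0 : \det C != 0 by rewrite -unitfE -unitmxE.
have b0 : b != 0 by apply: contraNneq C0 => b0; rewrite -bn b0 expr0n.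
apply/SL_orbitP; exists (b^-1 *: C); split.
  by rewrite detZ -bn exprVn mulVf // bn.
rewrite act_scale ?invr_eq0 // invrK; apply/esym/eqP; rewrite eqEsubv.
have bd : b ^+ d != 0 by rewrite expf_neq0.
apply/andP; split; rewrite -memvE; apply/vlineP; first by exists (b ^+ d).
by exists (b ^+ d)^-1; rewrite scalerA mulVf // scale1r.
Qed.

Lemma smooth_neq0 f : smooth_form f -> f != 0.
Proof.
move=> sf; apply/eqP => f0; have /(_ _ ord0)/eqP := sf (fun=> 1).
rewrite oner_eq0 => /(_ _)/negP[] // j; by rewrite f0 mderiv0 meval0.
Qed.

Definition orbit_cone g : set V := affine_cone (zariski_closure (SL_orbit <[g]>%VS)).

Lemma act_neq0 C f : C \in unitmx -> f != 0 -> act C f != 0.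
Proof.
move=> uC; apply: contra_neq => h.
rewrite -[f]act1 -(mulVmx uC) -act_mul ?unitmx_inv // h.
exact: linear0.
Qed.

Lemma act_orbit_cone g C : g != 0 -> C \in unitmx -> orbit_cone g (act C g).
Proof.
move=> g0 uC; right; split; first by rewrite dim_vline act_neq0.
by move=> k P _; apply; exact: SL_orbit_act.
Qed.

(** Vanishing of a form passes to the closure by definition; the positive degree takes care of the
    vertex 0 of the cone. *)
Lemma vanish_orbit_cone g k (P : {mpoly K[\dim {:V}]}) : P \is k.+1.-homog ->
  (forall C, C \in unitmx -> pol_eval P (act C g) = 0) ->
  forall a, orbit_cone g a -> pol_eval P a = 0.
Proof.
move=> hP van a [->|[_ /(_ _ _ hP) h]]; first exact: pol_eval0 hP.
apply: h; last exact: memv_line.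
move=> L /SL_orbitP[C [hC ->]] v /vlineP[b ->].
by rewrite (pol_evalZ _ _ hP) van ?mulr0 // unit_det1.
Qed.

End Orbits.

(** * The orbit map *)

Lemma mxvec_index_eq m n (i a : 'I_m) (j b : 'I_n) :
  (mxvec_index i j == mxvec_index a b) = (i == a) && (j == b).
Proof.
apply/eqP/andP => [e|[/eqP -> /eqP ->] //].
have := mxvecE (delta_mx a b : 'M[int]_(m, n)) i j.
rewrite e mxvec_delta !mxE !eqxx /= => /eqP; rewrite eq_sym.
by case: (i == a) => //; case: (j == b).
Qed.

Section MapLinear.
Variables (K : fieldType) (n m : nat) (l : {scalar {mpoly K[n]}}).
Implicit Types G : {mpoly {mpoly K[n]}[m]}.

Lemma meval_map_mpoly G v :
  (map_mpoly l G).@[v] = l G.@[fun e => (v e)%:MP].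
Proof.
rewrite /map_mpoly /mmap raddf_sum [G.@[_]]mevalE (raddf_sum l) /=.
apply: eq_bigr => u _; rewrite mevalM mevalC.
have -> : (mmap1 (fun i => 'X_i : {mpoly K[m]}) u).@[v] = \prod_e v e ^+ u e.
  by rewrite -mevalX mpolyXE_id.
under [in RHS]eq_bigr do rewrite -rmorphXn.
by rewrite -rmorph_prod /= mulrC [_ * _%:MP]mulrC mul_mpolyC linearZ.
Qed.

Lemma mderiv_map_mpoly G e : (map_mpoly l G)^`M(e) = map_mpoly l G^`M(e).
Proof. by apply/mpolyP => u; rewrite !(mcoeff_mderiv, mcoeff_map_mpoly) raddfMn. Qed.

End MapLinear.

Section GenericMatrix.
Variables (K : closedFieldType) (n' d' : nat).
Local Notation n := n'.+1.
Local Notation d := d'.+2.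
Local Notation V := (dhomog n K d).
Local Notation S := {mpoly K[n]}.

(** The projection to degree [d] extends the coordinates of [V] to linear forms on all polynomials,
    which [map_mpoly] can apply to coefficients. *)
Definition homog_part (p : S) : V := DHomog (pihomogP (mdeg : measure n) d p).

Lemma homog_part_linear : linear homog_part.
Proof. by move=> a p q; apply: dhomog_inj; rewrite /= linearP. Qed.
HB.instance Definition _ := GRing.isLinear.Build K S V _ homog_part homog_part_linear.

Lemma homog_partE (g : V) : homog_part g = g.
Proof. by apply: dhomog_inj; rewrite /= pihomog_dE //; exact: dhomog_is_dhomog. Qed.

Variable g : V.

(** This is [p (M z)] for the generic matrix [M]: the outer variables are the [n * n] entries of
    [M], the coefficients are polynomials in [z]. *)
Definition generic_subst (p : S) : {mpoly S[n * n]} :=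
  mmap (@mpolyC (n * n) S \o @mpolyC n K)
    (fun i => \sum_j ('X_j : S)%:MP * 'X_(mxvec_index i j)) p.

Lemma generic_substE (p : S) (M : 'M[K]_n) :
  (generic_subst p).@[fun e => (mxvec M 0 e)%:MP]
    = p \mPo [tuple \sum_j M i j *: 'X_j | i < n].
Proof.
rewrite comp_mpolyEX /generic_subst /mmap raddf_sum /=; apply: eq_bigr => m _.
rewrite mevalM mevalC mul_mpolyC; congr (_ *: _).
rewrite comp_mpolyX /mmap1 rmorph_prod /=; apply: eq_bigr => i _.
rewrite rmorphXn /= tnth_mktuple; congr (_ ^+ _); rewrite raddf_sum /=.
by apply: eq_bigr => j _; rewrite mevalM mevalC mevalXU mxvecE mulrC mul_mpolyC.
Qed.

Definition eval_id (G : {mpoly S[n * n]}) : S :=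
  G.@[fun e => (mxvec 1%:M 0 e)%:MP].

Let eval_idD G1 G2 : eval_id (G1 + G2) = eval_id G1 + eval_id G2.
Proof. exact: mevalD. Qed.
Let eval_idM G1 G2 : eval_id (G1 * G2) = eval_id G1 * eval_id G2.
Proof. exact: mevalM. Qed.
Let eval_idE q : eval_id (generic_subst q) = q.
Proof.
rewrite /eval_id generic_substE -[RHS]comp_mpoly_id; congr (_ \mPo _).
apply: eq_from_tnth => i; rewrite !tnth_mktuple (bigD1 i) //= mxE eqxx scale1r.
by rewrite big1 ?addr0 // => j ji; rewrite mxE eq_sym (negPf ji) scale0r.
Qed.

Lemma generic_subst_deriv (p : S) a b :
  eval_id (generic_subst p)^`M(mxvec_index a b) = p^`M(a) * 'X_b.
Proof.
pose D q := eval_id (generic_subst q)^`M(mxvec_index a b).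
rewrite -[LHS]/(D p); have -> : D p = \sum_i p^`M(i) * D 'X_i.
  have gD q r : generic_subst (q + r) = generic_subst q + generic_subst r.
    exact: raddfD.
  have gM q r : generic_subst (q * r) = generic_subst q * generic_subst r.
    exact: rmorphM.
  apply: (mpoly_derivation (phi := idfun) (D := D)) => [q r|q r|c].
  - by rewrite /D gD mderivD eval_idD.
  - rewrite /D gM mderivM eval_idD !eval_idM.
    exact: (congr2 +%R (congr1 ( *%R _) (eval_idE r)) (congr1 ( *%R^~ _) (eval_idE q))).
  - by rewrite /D /generic_subst mmapC /= mderivC /eval_id meval0.
have DX i : D 'X_i = (i == a)%:R * 'X_b.
  rewrite /D /generic_subst mmapX mmap1U (raddf_sum (mderiv _)) /eval_id raddf_sum /=.
  under eq_bigr do rewrite mderiv_mulC mevalM mevalC mderivXU.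
  have [->|ia] := eqVneq i a.
    rewrite (bigD1 b) //= eqxx meval1 mulr1 mul1r big1 ?addr0 // => j jb.
    by rewrite mxvec_index_eq eqxx (negPf jb) meval0 mulr0.
  by rewrite mul0r big1 // => j _; rewrite mxvec_index_eq (negPf ia) meval0 mulr0.
rewrite (bigD1 a) //= DX eqxx mul1r big1 ?addr0 // => i /negPf ia.
by rewrite DX ia mul0r mulr0.
Qed.

Definition act_poly (i : 'I_(\dim {:V})) : {mpoly K[n * n]} :=
  map_mpoly (coord (vbasis {:V}) i \o homog_part) (generic_subst g).

(** Substituting [M z] is acting by the inverse of [M]. The formula makes sense at every [M], since
    [invmx] is an involution that fixes singular matrices. *)
Lemma act_poly_eval M i : (act_poly i).@[fun e => mxvec M 0 e] = coords (act (invmx M) g) i.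
Proof.
have actE : mpoly_of_dhomog (act (invmx M) g)
    = mpoly_of_dhomog g \mPo [tuple \sum_j M i j *: 'X_j | i < n].
  by rewrite /= /subst_inv invmxK.
rewrite /act_poly meval_map_mpoly generic_substE -actE.
exact: (congr1 (fun v : V => coords v i) (homog_partE (act (invmx M) g))).
Qed.

Lemma act_poly_deriv a b i :
  ((act_poly i)^`M(mxvec_index a b)).@[fun e => mxvec 1%:M 0 e]
    = coords (homog_part ((mpoly_of_dhomog g)^`M(a) * 'X_b)) i.
Proof. by rewrite mderiv_map_mpoly meval_map_mpoly -/(eval_id _) generic_subst_deriv. Qed.

(* The velocity at t = 0 of the curve t |-> g o (1 + t E_ab). *)
Lemma tangent_partial (P : {mpoly K[\dim {:V}]}) a b :
  (forall C, C \in unitmx -> pol_eval P (act C g) = 0) ->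
  pol_diff P g (homog_part ((mpoly_of_dhomog g)^`M(a) * 'X_b)) = 0.
Proof.
move=> van; pose E : 'M[K]_n := delta_mx a b.
pose rho e : {poly K} := (mxvec 1%:M 0 e)%:P + (mxvec E 0 e)%:P * 'X.
pose rF i := mmap polyC rho (act_poly i).
have rhoE t e : (rho e).[t] = mxvec (1%:M + t *: E) 0 e.
  by rewrite !hornerE linearD linearZ /= !mxE mulrC.
have rFE t i : (rF i).[t] = coords (act (invmx (1%:M + t *: E)) g) i.
  by rewrite horner_mmap -act_poly_eval; apply: meval_eq => e; rewrite rhoE.
pose r := mmap polyC rF P.
pose q : {poly K} := \det (map_mx polyC 1%:M + 'X *: map_mx polyC E).
have qE t : q.[t] = \det (1%:M + t *: E).
  rewrite -horner_evalE -det_map_mx; congr (\det _); apply/matrixP => i j.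
  by rewrite !mxE /= horner_evalE !hornerE.
(* Where [q] does not vanish the matrix [1 + t E] is invertible and [r] is zero; [q] is a nonzero
   polynomial because its value at 0 is 1. *)
have r0 : r = 0.
  apply: (@horner_eq0_poly _ r q) => [|t].
    apply/eqP => /(congr1 (horner^~ 0)); rewrite horner0 qE scale0r addr0 det1.
    by move/eqP; rewrite oner_eq0.
  rewrite qE => dt; rewrite horner_mmap -[RHS](van (invmx (1%:M + t *: E))).
    by apply: meval_eq => i; exact: rFE.
  by rewrite unitmx_inv unitmxE unitfE.
have := congr1 (fun p : {poly K} => p^`().[0]) r0.
rewrite deriv0 horner0 => <-; rewrite deriv_mmap horner_sum; apply: eq_bigr => i _.
rewrite hornerM horner_mmap; congr (_ * _).
  apply: meval_eq => j; rewrite rFE scale0r addr0.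
  have -> : invmx 1%:M = 1%:M :> 'M[K]_n by exact: invmx1.
  by rewrite act1.
rewrite -act_poly_deriv deriv_mmap horner_sum (bigD1 (mxvec_index a b)) //=.
have drho e : (rho e)^`().[0] = mxvec E 0 e by rewrite !derivE !hornerE.
rewrite [X in _ + X]big1 ?addr0 => [|e eab]; last first.
  by rewrite hornerM drho mxvec_delta mxE (negPf eab) andbF mulr0.
rewrite hornerM drho mxvec_delta mxE !eqxx mulr1 horner_mmap.
by apply: meval_eq => e; rewrite rhoE scale0r addr0.
Qed.

End GenericMatrix.

(** * The tangent space of the orbit closure *)

Section TangentSpace.
Variables (K : closedFieldType) (n' d' : nat).
Local Notation n := n'.+1.
Local Notation d := d'.+2.
Local Notation V := (dhomog n K d).
Local Notation dimV := (\dim {:V}).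
Hypothesis charK : [pchar K] =i pred0.
Hypothesis uncountableK : ~ countable [set: K].
Hypothesis socle_det : socle_in_det K n.
Hypothesis dim_lt : (n * n < dimV)%N.
Hypothesis top_degree : (n * d' = d)%N.
Variable g : V.
Hypothesis smoothg : smooth_form g.

Local Notation J := (in_ideal (fun i => (mpoly_of_dhomog g)^`M(i))).

Definition vanishes_on_orbit (P : {mpoly K[dimV]}) :=
  forall C : 'M[K]_n, C \in unitmx -> pol_eval P (act C g) = 0.

Lemma exists_vanishing : exists2 P, P != 0 & vanishes_on_orbit P.
Proof.
have [P P0 hP] := algebraic_dependence (act_poly g) dim_lt.
exists P => // C uC; rewrite -[RHS](hP (fun e => mxvec (invmx C) 0 e)).
by apply: meval_eq => i; rewrite act_poly_eval invmxK.
Qed.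

(** The orbit is stable under nonzero scalars, which are [d]-th powers. Hence the polynomial in [c]
    with coefficients [P_i(b)], namely [P(c b)], has only zero coefficients. *)
Lemma vanishing_pihomog P k : vanishes_on_orbit P ->
  vanishes_on_orbit (pihomog mdeg k P).
Proof.
move=> hP C uC; have [sk|ks] := leqP (msize P) k.
  by rewrite pihomog_gt // /pol_eval meval0.
pose b := act C g.
pose q : {poly K} := \poly_(i < msize P) pol_eval (pihomog mdeg i P) b.
have q0 : q = 0.
  apply: (horner_eq0_poly (negbT (polyX_eq0 K))) => c; rewrite hornerX => c0.
  have [a ac] := exists_root_exp c (ltn0Sn d'.+1).
  have a0 : a != 0 by apply: contraNneq c0 => a0; rewrite -ac a0 expr0n.
  have ua : a^-1 *: C \in unitmx by rewrite unitmxZ // unitfE invr_eq0.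
  have := hP _ ua; rewrite act_scale ?invr_eq0 // invrK ac => <-.
  rewrite horner_poly [in RHS](pihomog_partitionE (leqnn (msize P))) /pol_eval raddf_sum.
  apply: eq_bigr => i _; rewrite mulrC; apply/esym/pol_evalZ; exact: pihomogP.
have := coef_poly (msize P) (fun i => pol_eval (pihomog mdeg i P) b) k.
by rewrite ks -/q q0 coef0 => <-.
Qed.

Lemma exists_vanishing_homog : exists k P,
  [/\ P \is k.-homog, P != 0 & vanishes_on_orbit P].
Proof.
have [P P0 hP] := exists_vanishing.
have [k Pk] : exists k, pihomog mdeg k P != 0.
  apply: contrapT => h; case/eqP: P0.
  rewrite (pihomog_partitionE (leqnn (msize P))) big1 // => i _.
  by apply/eqP; apply: contrapT => /negP Pi; apply: h; exists i.
exists k, (pihomog mdeg k P); split=> //; [exact: pihomogP|exact: vanishing_pihomog].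
Qed.

(* A nonzero form P of least degree vanishing on the orbit has a partial
   derivative not vanishing at some point M.g; pull P back along M. *)
Lemma exists_submersion : exists2 P,
  (forall a, orbit_cone g a -> pol_eval P a = 0) & exists w, pol_diff P g w != 0.
Proof.
have exk : exists k, `[< exists P, [/\ P \is k.-homog, P != 0 & vanishes_on_orbit P] >].
  by have [k hk] := exists_vanishing_homog; exists k; apply/asboolP.
case: (ex_minnP exk) => k /asboolP[P [homP P0 hP]] mink.
case: k homP mink => [|k] homP mink.
  have uI : 1%:M \in @unitmx K n by exact: unitmx1.
  case/eqP: P0; have PC : P = (P@_0%MM)%:MP.
    apply: msize1_polyC; rewrite msizeE; apply/bigmax_leqP_seq => m hm _.
    by rewrite (dhomog_mdeg homP hm).
  by have := hP _ uI; rewrite /pol_eval PC mevalC => ->; rewrite mpolyC0.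
have [i Pi] : exists i, P^`M(i) != 0.
  apply/existsP; apply: contra_neqT P0 => /existsPn dP.
  have := mderiv_euler homP; rewrite big1 => [/esym/eqP|i _].
    rewrite mscalerI => /orP[/(natf0_pchar (ltn0Sn k))[p]|/eqP //].
    by rewrite charK.
  by have := dP i; rewrite negbK => /eqP ->; rewrite mul0r.
have [C uC PC] : exists2 C : 'M[K]_n, C \in unitmx & pol_eval P^`M(i) (act C g) != 0.
  apply: contrapT => h.
  have /mink : `[< exists P, [/\ P \is k.-homog, P != 0 & vanishes_on_orbit P] >].
    apply/asboolP; exists P^`M(i); split=> //; first exact: dhomog_mderiv homP.
    by move=> C uC; apply/eqP; apply: contrapT => /negP PC; apply: h; exists C.
  by rewrite ltnn.
pose l : {linear V -> V} := @act K n' d' C.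
have lE v : l v = act C v by [].
exists (pull_back l P).
  apply: (@vanish_orbit_cone _ _ _ g k); first exact: pull_back_homog.
  move=> D uD; rewrite pull_back_eval lE act_mul //; apply: hP.
  by rewrite unitmx_mul uC.
exists (act (invmx C) (vbasis {:V})`_i).
by rewrite pull_back_diff !lE act_mul ?unitmx_inv // mulmxV // act1 pol_diff_basis.
Qed.

(** In degree [d] only the linear terms of the coefficients [a i] contribute, and the products of a
    variable with a partial derivative are velocities of curves in the orbit. *)
Lemma pol_diff_jacobian P w :
  (forall a, orbit_cone g a -> pol_eval P a = 0) ->
  J (mpoly_of_dhomog w) -> pol_diff P g w = 0.
Proof.
move=> hP [a wE].
have van C : C \in unitmx -> pol_eval P (act C g) = 0.
  by move=> uC; apply/hP/act_orbit_cone => //; exact: smooth_neq0.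
have homg i : (mpoly_of_dhomog g)^`M(i) \is d'.+1.-homog.
  by apply: dhomog_mderiv; exact: dhomog_is_dhomog.
rewrite -[w]homog_partE wE linear_sum /=.
elim/big_ind: _ => [|v1 v2 h1 h2|i _].
- by rewrite -(scale0r 0) pol_diffZ mul0r.
- by rewrite pol_diffD h1 h2 addr0.
elim/mpolyind: (a i) => [|c m p _ _ IH].
  by rewrite mul0r linear0 -(scale0r 0) pol_diffZ mul0r.
rewrite mulrDl -scalerAl linearP /= pol_diffD pol_diffZ IH addr0.
have [/mdeg1P[b /eqP ->]|m1] := boolP (mdeg m == 1%N).
  by rewrite ['X_b * _]mulrC tangent_partial // mulr0.
have -> : homog_part d' ('X_[m] * (mpoly_of_dhomog g)^`M(i)) = 0.
  apply: dhomog_inj; rewrite /=; apply: (pihomog_ne0 (d := (mdeg m + d'.+1)%N)).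
    by rewrite -(add1n d'.+1) eqn_add2r.
  by rewrite dhomogM ?dhomogX.
by rewrite -(scale0r 0) pol_diffZ mul0r mulr0.
Qed.

(** By [top_degree] the Hessian [H] lies in [V], and [V] is spanned by the degree [d] part of [J]
    together with [H]. The differential of [P] kills the former and is nonzero, so it is nonzero at
    [H], and a tangent vector has no component along [H]. *)
Lemma tangent_spaceE : tangent_space (orbit_cone g) g = [set w | J (mpoly_of_dhomog w)].
Proof.
have homf : mpoly_of_dhomog g \is d.-homog by exact: dhomog_is_dhomog.
apply/seteqP; split=> w; last by move=> hw P hP; exact: pol_diff_jacobian.
move=> hw; have [P hP [u Pu]] := exists_submersion.
have hessd : hessian g \is d.-homog by rewrite -top_degree; exact: hessian_homog.
pose H : V := DHomog hessd.
have decomp (v : V) : exists c, J (mpoly_of_dhomog (v - c *: H)).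
  have [j|c hc] := jacobian_socle charK uncountableK socle_det homf smoothg
      (g := mpoly_of_dhomog v).
    apply: (jacobian_top_socle charK uncountableK socle_det homf smoothg).
    by rewrite top_degree; exact: dhomog_is_dhomog.
  by exists c.
have dP v c : J (mpoly_of_dhomog (v - c *: H)) -> pol_diff P g v = c * pol_diff P g H.
  move=> /(pol_diff_jacobian hP) e.
  by rewrite -[v](subrK (c *: H)) pol_diffD e add0r pol_diffZ.
have [cu /dP ue] := decomp u; have [c hc] := decomp w.
have := hw P hP; rewrite (dP _ _ hc) => /eqP.
have PH : pol_diff P g H != 0 by apply: contraNneq Pu => h; rewrite ue h mulr0.
rewrite mulf_eq0 (negPf PH) orbF => /eqP c0.
by move: hc; rewrite c0 scale0r subr0.
Qed.

End TangentSpace.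

(** * Comparison of the two maps on an orbit *)

Section Main.
Variables (K : closedFieldType) (n' d' : nat).
Local Notation n := n'.+1.
Local Notation d := d'.+2.
Local Notation N := (n * (d - 2))%N.
Local Notation V := (dhomog n K d).
Hypothesis charK : [pchar K] =i pred0.
Hypothesis uncountableK : ~ countable [set: K].
Hypothesis socle_det : socle_in_det K n.

Local Notation J g := (in_ideal (fun i => (mpoly_of_dhomog g)^`M(i))).

Lemma smoothZ a (f : V) : a != 0 -> smooth_form f -> smooth_form (a *: f).
Proof.
move=> a0 sf z hz; apply: sf => j; have /eqP := hz j.
by rewrite /= mderivZ mevalZ mulf_eq0 (negPf a0) => /eqP.
Qed.

(** The representative chosen by [vpick] is a nonzero multiple of some [act C f], hence smooth.
    Since the orbit can be based at it, the tangent space is needed only at the base point. *)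
Lemma smooth_point_orbit x y : smooth_point x -> SL_orbit x y ->
  exists g : V, [/\ smooth_form g, g = vpick y, y = <[g]>%VS & SL_orbit x = SL_orbit <[g]>%VS].
Proof.
move=> [f sf ->] xy; have /SL_orbitP[C [hC yE]] := xy.
have uC : C \in unitmx by rewrite unitmxE hC unitr1.
have /vlineP[a ga] : vpick y \in <[act C f]>%VS by rewrite -yE memv_pick.
have y0 : y != 0%VS by rewrite -dimv_eq0 yE dim_vline act_neq0 // smooth_neq0.
have a0 : a != 0 by apply: contraNneq y0 => a0; rewrite -vpick0 ga a0 scale0r.
have yg : y = <[vpick y]>%VS.
  apply/eqP; rewrite eqEsubv -[(<[_]> <= y)%VS]memvE memv_pick andbT [X in (X <= _)%VS]yE.
  rewrite -memvE ga; apply/vlineP; exists a^-1.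
  by rewrite scalerA mulVf // scale1r.
exists (vpick y); split=> //; last by rewrite -yg (SL_orbit_eq xy).
by rewrite ga; apply: smoothZ => //; exact: act_smooth.
Qed.

Lemma phiE x y : (n * n < \dim {:V})%N -> (n * d' = d)%N -> smooth_point x -> SL_orbit x y ->
  phi x y = [set w : V | J (vpick y) (mpoly_of_dhomog w)].
Proof.
move=> hdim hd sx xy; have [g [sg gy _ Sxg]] := smooth_point_orbit sx xy.
rewrite /phi Sxg -gy; exact: tangent_spaceE.
Qed.

Lemma polar_neq0 (g : V) : smooth_form g -> polar d' (associated_form g) != 0.
Proof.
move=> sg; have hH : hessian g \is N.-homog.
  by rewrite subn2; apply: hessian_homog; exact: dhomog_is_dhomog.
apply/eqP => p0; have := polarE charK uncountableK socle_det sg (DHomog hH).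
rewrite p0 lfunE /=; have [_ _ _ ->] := omegaP charK uncountableK socle_det sg.
by move/esym/eqP; rewrite oner_eq0.
Qed.

Lemma polar_eq0 (g : V) (w : dhomog n K N) : smooth_form g ->
  polar d' (associated_form g) w = 0 <-> J g (mpoly_of_dhomog w).
Proof.
move=> sg; rewrite (polarE charK uncountableK socle_det sg) omega_eq0 //.
exact: dhomog_is_dhomog.
Qed.

Lemma polar_corresponds (g : V) : smooth_form g ->
  corresponds <[polar d' (associated_form g)]>%VS
    [set w : dhomog n K N | J g (mpoly_of_dhomog w)].
Proof.
move=> sg; split; first by rewrite dim_vline polar_neq0.
apply/seteqP; split=> w /= => [/(polar_eq0 w sg) pw l /vlineP[c ->]|].
  by rewrite lfunE /= pw scaler0.
by move=> /(_ _ (memv_line _)) pw; apply/(polar_eq0 w sg).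
Qed.

End Main.

Theorem theorem3p3 (R : realType) :
  (forall x : {vspace dhomog 2 R[i] 4}, smooth_point x ->
   forall y : {vspace dhomog 2 R[i] 4}, SL_orbit x y ->
     corresponds (V := dhomog 2 R[i] 4) (Phi y) (phi x y))
  /\
  (forall x : {vspace dhomog 3 R[i] 3}, smooth_point x ->
   forall y : {vspace dhomog 3 R[i] 3}, SL_orbit x y ->
     corresponds (V := dhomog 3 R[i] 3) (Phi y) (phi x y)).
Proof.
have charK : [pchar R[i]] =i pred0 := Num.Theory.pchar_num R[i].
have unc := @uncountable_complex R.
split=> x sx y xy; have [g [sg gy _ _]] := smooth_point_orbit sx xy.
(* The numerical conditions are [2 * 2 < 5] and [2 * 2 = 4] here, [3 * 3 < 10] and [3 * 1 = 3] in
   the second case. *)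
- rewrite (phiE charK unc (@socle_in_det2 R[i]) _ _ sx xy) ?dimvf // /Phi -gy.
  exact: (@polar_corresponds R[i] 1 2 charK unc (@socle_in_det2 R[i])).
- rewrite (phiE charK unc (@socle_in_det3 R[i]) _ _ sx xy) ?dimvf // /Phi -gy.
  exact: (@polar_corresponds R[i] 2 1 charK unc (@socle_in_det3 R[i])).
Qed.
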